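(* Let $\omega=(\alpha,\beta)\in\Omega$ be an element of the Thoma simplex and let $T^\omega$ be the corresponding simple unitary spherical representation of $S_\infty\times S_\infty$ over $\mathbb{C}$. If either $\gamma(\alpha,\beta)<1$, or $\alpha_i>0$ for all $i$, or $\beta_j>0$ for all $j$, then $$\mathrm{lAnn}\, T^\omega=\mathrm{rAnn}\, T^\omega=0.$$ In the remaining cases, $$\mathrm{lAnn}\, T^\omega=\mathrm{rAnn}\, T^\omega=\mathfrak{P}_{m,n},$$ with $m:=\max\{i\mid\alpha_i\neq0\}$ and $n:=\max\{i\mid\beta_i\ne0\}$ (the maximum of the empty set being $0$).
   Context: $S_n$ is the symmetric group on $\{1,\dots,n\}$, $S_n\subset S_{n+1}$ canonically, $S_\infty=\bigcup_n S_n$, $\mathbb{C}S_\infty=\bigcup_n\mathbb{C}S_n$. The Thoma simplex $\Omega\subset[0,1]^{\mathbb{Z}_{>0}}\times[0,1]^{\mathbb{Z}_{>0}}$ is the set of pairs $\omega=(\alpha,\beta)$ with $\alpha_1\ge\alpha_2\ge\cdots$, $\beta_1\ge\beta_2\ge\cdots$ and $\gamma(\alpha,\beta):=\sum_{i\ge1}(\alpha_i+\beta_i)\le1$. By Thoma's theorem, $\Omega$ parametrises the extreme characters of $S_\infty$: $\chi^\omega(\sigma)=\prod_{c}\left(\sum_i\alpha_i^{|c|}+(-1)^{|c|-1}\sum_i\beta_i^{|c|}\right)$, the product being over the non-trivial cycles $c$ of $\sigma$, of length $|c|\ge2$. A unitary representation of $S_\infty\times S_\infty$ is spherical if it contains a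 spherical vector, i.e. a non-zero vector fixed by the diagonal subgroup $\{(g,g)\mid g\in S_\infty\}$. $T^\omega$ is the (unique up to isomorphism) irreducible unitary spherical representation such that for a normalised spherical vector $v$ one has $\chi^\omega(g)=((g,e)v,v)$ for all $g\in S_\infty$; $\omega\mapsto T^\omega$ is a bijection between $\Omega$ and isomorphism classes of irreducible unitary spherical representations. $\mathrm{lAnn}\,V$ (resp. $\mathrm{rAnn}\,V$) is the annihilator ideal in $\mathbb{C}S_\infty$ of the restriction of $V$ to the left factor $S_\infty\times\{e\}$ (resp. right factor $\{e\}\times S_\infty$). For two-sided ideals $I,J$ of $\mathbb{C}S_\infty$, with $I_n:=I\cap\mathbb{C}S_n$, the ideal $I\dagger J$ is given by $(I\dagger J)_n=\bigcap_{i=0}^n\mathrm{Ann}_{\mathbb{C}S_n}\mathrm{Ind}^{S_n}_{S_i\times S_{n-i}}(\mathbb{C}S_i/I_i\boxtimes\mathbb{C}S_{n-i}/J_{n-i})$ for $n\geq 1$, with $S_0$ trivial and $I_0=J_0=0$ by convention; $\dagger$ is commutative and associative with identity element $\mathbb{C}S_\infty$. $J_+$ and $J_-$ are the annihilator ideals of the trivial and sign representations of $S_\infty$, and $\mathfrak{P}_{m,n}:=J_+^{\dagger m}\dagger J_-^{\dagger n}$. *)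

(* Defs.v *)
From HB Require Import structures.
From mathcomp Require Import all_boot all_order all_algebra all_fingroup.
(* monalg has to be imported before the analysis library: their notations
   clash in the other order. *)
From mathcomp Require Import finmap monalg complex.
From mathcomp Require Import boolp classical_sets reals ereal.
From mathcomp Require Import topology normedtype sequences.
Set Implicit Arguments.
Unset Strict Implicit.
Unset Printing Implicit Defensive.
Import Order.TTheory GRing.Theory Num.Theory.
Import numFieldNormedType.Exports.
Local Open Scope classical_set_scope.
Local Open Scope ring_scope.

(* {malg K[X]} is the vector space with basis X; for a group G it is the
   underlying space of the group algebra of G. *)
Section LinearExtension.
Variables (K : fieldType) (X : choiceType) (V : lmodType K).

Definition mlin (f : X -> V) (a : {malg K[X]}) : V :=
  \sum_(x <- msupp a) a@_x *: f x.

Lemma mlinEw (f : X -> V) (d : {fset X}%fset) a :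
  (msupp a `<=` d)%fset -> mlin f a = \sum_(x <- d) a@_x *: f x.
Proof.
move=> le; rewrite [LHS](big_fset_incl _ le) => //= x xd /mcoeff_outdom ->.
by rewrite scale0r.
Qed.

Lemma mlin_is_linear f : linear (mlin f).
Proof.
move=> c a b; pose d := (msupp (c *: a + b) `|` msupp a `|` msupp b)%fset.
rewrite (@mlinEw _ d (c *: a + b)) ?(@mlinEw _ d a) ?(@mlinEw _ d b).
- rewrite scaler_sumr -big_split; apply: eq_bigr => x _ /=.
  by rewrite mcoeffD mcoeffZ scalerDl scalerA.
- by rewrite /d finmap.fsubsetUr.
- by rewrite /d -finmap.fsetUA finmap.fsetUCA finmap.fsubsetUl.
- by rewrite /d -finmap.fsetUA finmap.fsubsetUl.
Qed.
HB.instance Definition _ f :=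
  GRing.isLinear.Build K {malg K[X]} V _ (mlin f) (mlin_is_linear f).

Lemma mlinU f x : mlin f << x >> = f x.
Proof.
by rewrite (mlinEw _ msuppU_le) finmap.big_seq_fset1 mcoeffUU scale1r.
Qed.

Lemma malg_basisP (f g : {linear {malg K[X]} -> V}) :
  (forall x, f << x >> = g << x >>) -> f =1 g.
Proof.
move=> fg a; rewrite (monalgE a) !raddf_sum; apply: eq_bigr => x _ /=.
have -> : << a@_x *g x >> = a@_x *: << x >> :> {malg K[X]}.
  by apply/malgP => k; rewrite mcoeffZ !mcoeffU mulrnAr mulr1.
by rewrite !linearZ /= fg.
Qed.

End LinearExtension.

Definition mpush (K : fieldType) (X Y : choiceType) (f : X -> Y) :
  {malg K[X]} -> {malg K[Y]} := mlin (fun x => << f x >>).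

Lemma mpush_is_linear (K : fieldType) (X Y : choiceType) (f : X -> Y) :
  linear (@mpush K X Y f).
Proof. exact: mlin_is_linear. Qed.
HB.instance Definition _ (K : fieldType) (X Y : choiceType) (f : X -> Y) :=
  GRing.isLinear.Build K {malg K[X]} {malg K[Y]} _ (@mpush K X Y f)
    (@mpush_is_linear K X Y f).

Lemma mpushU (K : fieldType) (X Y : choiceType) (f : X -> Y) x : @mpush K X Y f << x >> = << f x >>.
Proof. exact: mlinU. Qed.

Lemma eq_mpush (K : fieldType) (X Y : choiceType) (f g : X -> Y) :
  f =1 g -> @mpush K X Y f =1 mpush g.
Proof. by move=> fg a; apply: eq_bigr => x _; rewrite fg. Qed.

Lemma mpush_id (K : fieldType) (X : choiceType) (f : X -> X) :
  f =1 id -> @mpush K X X f =1 id.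
Proof.
move=> fE; apply: (@malg_basisP K X _ (mpush f) idfun) => x.
by apply: etrans (mpushU _ _ _) _; rewrite fE.
Qed.

Lemma mpush_comp (K : fieldType) (X Y Z : choiceType) (f : Y -> Z) (g : X -> Y)
  (a : {malg K[X]}) : mpush f (mpush g a) = mpush (f \o g) a.
Proof.
apply: (@malg_basisP K X _ (mpush f \o mpush g) (mpush (f \o g))) => x.
apply: etrans (esym (mpushU _ _ _)).
by apply: etrans (congr1 _ (mpushU _ _ _)) (mpushU _ _ _).
Qed.

Definition subspace (K : fieldType) (V : lmodType K) (S : set V) : Prop :=
  S 0 /\ forall (c : K) u v, S u -> S v -> S (c *: u + v).

Section LinearQuotient.
Variables (K : fieldType) (V : lmodType K) (N : set V).

Definition lspan : set V := [set v | forall S, subspace S -> N `<=` S -> S v].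

Lemma lspan_subspace : subspace lspan.
Proof.
split=> [S [] //|c u v Hu Hv S SS NS]; apply: SS.2; [exact: Hu|exact: Hv].
Qed.

Definition lspanb : {pred V} := fun v => `[< lspan v >].

Lemma lspanP v : reflect (lspan v) (v \in lspanb).
Proof. exact: asboolP. Qed.

Lemma lspan_zmod_closed : zmod_closed lspanb.
Proof.
split=> [|u v]; first by apply/lspanP; case: lspan_subspace.
move=> /lspanP Hu /lspanP Hv; apply/lspanP.
by rewrite addrC -scaleN1r; apply: lspan_subspace.2.
Qed.
HB.instance Definition _ := GRing.isZmodClosed.Build V lspanb lspan_zmod_closed.

Lemma lspanZ c v : v \in lspanb -> c *: v \in lspanb.
Proof.
move=> /lspanP Hv; apply/lspanP; rewrite -[_ *: _]addr0.
by apply: lspan_subspace.2 => //; case: lspan_subspace.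
Qed.

Definition lquot := @Quotient.quot V lspanb.
HB.instance Definition _ := Choice.on lquot.
HB.instance Definition _ := GRing.Zmodule.on lquot.

Definition lproj (v : V) : lquot := \pi_(@Quotient.quot V lspanb)%qT v.
Definition lrepr (x : lquot) : V := generic_quotient.repr x.

Lemma lreprK : cancel lrepr lproj.
Proof. by move=> x; rewrite /lproj /lrepr reprK. Qed.

Lemma lprojE u v : (lproj u == lproj v) = (u - v \in lspanb).
Proof. by rewrite /lproj Quotient.idealrBE. Qed.

Lemma lprojD : {morph lproj : u v / u + v}.
Proof. by move=> u v; rewrite /lproj raddfD. Qed.

Definition lqscale (c : K) (x : lquot) : lquot := lproj (c *: lrepr x).

Lemma lqscaleE c v : lqscale c (lproj v) = lproj (c *: v).
Proof.
apply/eqP; rewrite lprojE -scalerBr; apply: lspanZ.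
by rewrite -lprojE lreprK.
Qed.

Fact lqscaleA a b x : lqscale a (lqscale b x) = lqscale (a * b) x.
Proof. by rewrite -[x]lreprK !lqscaleE scalerA. Qed.
Fact lqscale1 : left_id 1 lqscale.
Proof. by move=> x; rewrite -[x]lreprK lqscaleE scale1r. Qed.
Fact lqscaleDr : right_distributive lqscale +%R.
Proof.
by move=> c x y; rewrite -[x]lreprK -[y]lreprK -lprojD !lqscaleE scalerDr lprojD.
Qed.
Fact lqscaleDl x : {morph lqscale^~ x : a b / a + b}.
Proof. by move=> a b; rewrite -[x]lreprK !lqscaleE scalerDl lprojD. Qed.

HB.instance Definition _ := GRing.Zmodule_isLmodule.Build K lquot
  lqscaleA lqscale1 lqscaleDr lqscaleDl.

Fact lproj_is_linear : linear lproj.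
Proof. by move=> c u v; rewrite lprojD -lqscaleE. Qed.
HB.instance Definition _ :=
  GRing.isLinear.Build K V lquot _ lproj lproj_is_linear.

Lemma lproj_eq0 v : (lproj v == 0) = (v \in lspanb).
Proof. by rewrite -(raddf0 lproj) lprojE subr0. Qed.

End LinearQuotient.

Section LinearProp.
Variables (K : fieldType) (V V' : lmodType K) (f : V -> V').
Hypothesis f_linear : linear f.

Lemma linear_propB : {morph f : u v / u - v}.
Proof.
by move=> u v; rewrite -scaleN1r addrC f_linear scaleN1r addrC.
Qed.

Lemma linear_prop0 : f 0 = 0.
Proof. by rewrite -(subrr 0) linear_propB subrr. Qed.

End LinearProp.

Section QuotientMap.
Variables (K : fieldType) (V V' : lmodType K) (N : set V) (N' : set V').
Variable f : V -> V'.

Definition lqmap (x : lquot N) : lquot N' := lproj N' (f (lrepr x)).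

Hypotheses (f_linear : linear f) (fN : forall v, N v -> lspan N' (f v)).

Lemma lspan_map v : lspan N v -> lspan N' (f v).
Proof.
have [S0 S1] := lspan_subspace N'.
move=> /(_ [set v | lspan N' (f v)]); apply=> //.
split=> [|c u w]; first by rewrite /= linear_prop0.
by move=> /= Hu Hw; rewrite f_linear; apply: S1.
Qed.

Lemma lqmapE v : lqmap (lproj N v) = lproj N' (f v).
Proof.
apply/eqP; rewrite lprojE -linear_propB //; apply/lspanP.
apply: lspan_map; apply/lspanP.
by rewrite -lprojE lreprK.
Qed.

Lemma lqmap_linear : linear lqmap.
Proof.
move=> c x y; rewrite -[x]lreprK -[y]lreprK -linearP !lqmapE -linearP.
by rewrite f_linear.
Qed.

End QuotientMap.

Arguments lqmap {K V V'} N N' f x.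

Section Tensor.
Variables (K : fieldType) (V W : lmodType K).

Definition tensor_rel : set {malg K[(V * W)%type]} := [set r | exists (c : K) v v' w w',
     r = << (c *: v + v', w) >> - c *: << (v, w) >> - << (v', w) >>
  \/ r = << (v, c *: w + w') >> - c *: << (v, w) >> - << (v, w') >>].

Definition tensor := lquot tensor_rel.
HB.instance Definition _ := GRing.Lmodule.on tensor.

Definition tens (v : V) (w : W) : tensor := lproj tensor_rel << (v, w) >>.

End Tensor.

Section TensorMap.
Variables (K : fieldType) (V W V' W' : lmodType K).
Variables (f : V -> V') (g : W -> W').

Definition tensor_map : tensor V W -> tensor V' W' :=
  lqmap (@tensor_rel K V W) (@tensor_rel K V' W') (mpush (fun p => (f p.1, g p.2))).

Hypotheses (f_linear : linear f) (g_linear : linear g).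

Lemma tensor_map_rel r : tensor_rel r ->
  lspan (@tensor_rel K V' W') (mpush (fun p => (f p.1, g p.2)) r).
Proof.
move=> [c [v [v' [w [w' rE]]]]] S SS; apply.
exists c, (f v), (f v'), (g w), (g w').
by case: rE => ->; rewrite !linearB linearZ /= !mpushU /= ?f_linear ?g_linear;
  [left | right].
Qed.

Lemma tensor_map_linear : linear tensor_map.
Proof. exact: (lqmap_linear (@mpush_is_linear _ _ _ _) tensor_map_rel). Qed.

Lemma tensor_mapE v w : tensor_map (tens v w) = tens (f v) (g w).
Proof.
rewrite /tensor_map /tens.
by rewrite (lqmapE (@mpush_is_linear _ _ _ _) tensor_map_rel) mpushU.
Qed.

End TensorMap.

Lemma tensor_ext (K : fieldType) (V W : lmodType K) (U : lmodType K)
    (f g : tensor V W -> U) : linear f -> linear g ->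
  (forall v w, f (tens v w) = g (tens v w)) -> f =1 g.
Proof.
move=> fl gl fg x; rewrite -[x]lreprK.
pose F : {linear _ -> _} := HB.pack f (GRing.isLinear.Build K _ _ _ f fl).
pose G : {linear _ -> _} := HB.pack g (GRing.isLinear.Build K _ _ _ g gl).
pose p : {linear {malg K[(V * W)%type]} -> tensor V W} := @lproj K _ (@tensor_rel K V W).
by apply: (@malg_basisP _ _ _ (F \o p) (G \o p)) => -[v w]; apply: fg.
Qed.

Section GroupModules.
Variable K : fieldType.

Record gmodule (G : groupType) := GModule {
  gsort :> lmodType K;
  gact : G -> gsort -> gsort;
  gact_linear : forall g, linear (gact g);
  gact1 : forall v, gact 1%g v = v;
  gactM : forall g h v, gact (g * h)%g v = gact g (gact h v)
}.

Definition galg_act (G : groupType) (V : gmodule G) (a : {malg K[G]}) (v : V) :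
  V := mlin (fun g => gact g v) a.

Definition Ann (G : groupType) (V : gmodule G) : set {malg K[G]} :=
  [set a | forall v : V, galg_act a v = 0].

Section Res.
Variables (H G : groupType) (phi : UMagmaMorphism.type H G) (V : gmodule G).
Lemma res_act1 v : gact (phi 1%g) v = v :> V.
Proof. by rewrite gmulf1 gact1. Qed.
Lemma res_actM g h v : gact (phi (g * h)%g) v = gact (phi g) (gact (phi h) v) :> V.
Proof. by rewrite gmulfM gactM. Qed.
Definition res : gmodule H :=
  GModule (fun h => @gact_linear G V (phi h)) res_act1 res_actM.
End Res.

Section Regular.
Variable G : groupType.
Definition regular_act (g : G) : {malg K[G]} -> {malg K[G]} := mpush (mulg g).
Lemma regular_act_linear g : linear (regular_act g).
Proof. exact: mpush_is_linear. Qed.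
Lemma regular_act1 a : regular_act 1%g a = a.
Proof.
by apply: mpush_id => x; rewrite mul1g.
Qed.
Lemma regular_actM g h a :
  regular_act (g * h)%g a = regular_act g (regular_act h a).
Proof.
rewrite /regular_act mpush_comp; apply: eq_mpush => x.
by rewrite /= mulgA.
Qed.
Definition regular : gmodule G :=
  GModule regular_act_linear regular_act1 regular_actM.
End Regular.

(* Quotient of V by the submodule generated by N. *)
Section Quotient.
Variables (G : groupType) (V : gmodule G) (N : set V).
Definition gsat : set V := [set v | exists (g : G) (x : V), N x /\ v = gact g x].
Definition gquot_act (g : G) : lquot gsat -> lquot gsat := lqmap gsat gsat (gact g).
Let gstab g v : gsat v -> lspan gsat (gact g v).
Proof.
move=> [h [x [Nx ->]]] S SS; apply; exists (g * h)%g, x; split=> //.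
by rewrite gactM.
Qed.
Lemma gquot_act_linear g : linear (gquot_act g).
Proof. exact: (lqmap_linear (@gact_linear G V g) (gstab g)). Qed.
Lemma gquot_actE g v : gquot_act g (lproj gsat v) = lproj gsat (gact g v).
Proof. exact: (lqmapE (@gact_linear G V g) (gstab g)). Qed.
Lemma gquot_act1 x : gquot_act 1%g x = x.
Proof. by rewrite -[x]lreprK gquot_actE gact1. Qed.
Lemma gquot_actM g h x : gquot_act (g * h)%g x = gquot_act g (gquot_act h x).
Proof. by rewrite -[x]lreprK !gquot_actE gactM. Qed.
Definition gquot : gmodule G := GModule gquot_act_linear gquot_act1 gquot_actM.
End Quotient.

Section ExternalTensor.
Variables (G H : groupType) (V : gmodule G) (W : gmodule H).
Definition etens_act (p : (G * H)%type) : tensor V W -> tensor V W :=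
  tensor_map (gact p.1) (gact p.2).
Lemma etens_act_linear p : linear (etens_act p).
Proof. by apply: tensor_map_linear; apply: gact_linear. Qed.
Lemma etens_actE p v w : etens_act p (tens v w) = tens (gact p.1 v) (gact p.2 w).
Proof. by rewrite /etens_act tensor_mapE; try exact: gact_linear. Qed.
Lemma etens_act1 x : etens_act 1%g x = x.
Proof.
apply: (tensor_ext (f := etens_act 1%g) (g := id)) => // [|v w].
  exact: etens_act_linear.
by rewrite etens_actE !gact1.
Qed.
Lemma etens_actM p q x : etens_act (p * q)%g x = etens_act p (etens_act q x).
Proof.
apply: (tensor_ext (f := etens_act (p * q)%g)
  (g := etens_act p \o etens_act q)) => [||v w].
- exact: etens_act_linear.
- by move=> c u v /=; rewrite !etens_act_linear.
by rewrite /= !etens_actE /= !gactM.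
Qed.
Definition etens : gmodule (G * H)%type :=
  GModule etens_act_linear etens_act1 etens_actM.
End ExternalTensor.

End GroupModules.

Section PairInjections.
Variables G H : groupType.
Definition linj (g : G) : (G * H)%type := (g, 1%g).
Definition rinj (h : H) : (G * H)%type := (1%g, h).
Lemma linj_morph : {morph linj : x y / (x * y)%g}.
Proof. by move=> x y; congr pair; rewrite /= mulg1. Qed.
Lemma rinj_morph : {morph rinj : x y / (x * y)%g}.
Proof. by move=> x y; congr pair; rewrite /= mulg1. Qed.
HB.instance Definition _ := monoid.isMultiplicative.Build G (G * H)%type linj linj_morph.
HB.instance Definition _ :=
  Multiplicative_isUMagmaMorphism.Build G (G * H)%type linj erefl.
HB.instance Definition _ := monoid.isMultiplicative.Build H (G * H)%type rinj rinj_morph.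
HB.instance Definition _ :=
  Multiplicative_isUMagmaMorphism.Build H (G * H)%type rinj erefl.
End PairInjections.

(* K[G] (x)_{K[H]} W, where G acts on the left-hand factor and H acts on the
   right of K[G] through phi. *)
Section Induction.
Variables (K : fieldType) (H G : groupType) (phi : UMagmaMorphism.type H G).
Variable W : gmodule K H.
Definition ind_pre : gmodule K G := res (@linj G H) (etens (regular K G) W).
Definition ind_rel : set ind_pre := [set r | exists (a : {malg K[G]}) h (w : W),
  r = tens (mpush (fun g => g * phi h)%g a : regular K G) w
      - tens (a : regular K G) (gact h w)].
Definition Ind : gmodule K G := gquot ind_rel.
End Induction.

(* The infinite symmetric group, acting on nat. Products follow the library's
   convention for 'S_n: (s * t)%g is s followed by t. *)
Record Sinf := MkSinf {
  sfun :> nat -> nat;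
  sinv : nat -> nat;
  sfunK : cancel sfun sinv;
  sinvK : cancel sinv sfun;
  sfin : exists n, forall k, (n <= k)%N -> sfun k = k
}.

Lemma sinf_eqP (s t : Sinf) : sfun s =1 sfun t -> s = t.
Proof.
case: s t => [f f' fK f'K finf] [g g' gK g'K fing] /= /funext fg.
move: fK f'K finf; rewrite {}fg => fK f'K finf.
have e : f' = g' by apply/funext => k; rewrite -{1}[k]g'K fK.
by move: fK f'K; rewrite e => fK f'K; congr MkSinf; apply: Prop_irrelevance.
Qed.

HB.instance Definition _ := gen_eqMixin Sinf.
HB.instance Definition _ := gen_choiceMixin Sinf.

Lemma sinv_fin (s : Sinf) : exists n, forall k, (n <= k)%N -> sinv s k = k.
Proof.
by have [n sn] := sfin s; exists n => k nk; rewrite -{1}(sn k nk) sfunK.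
Qed.
Lemma scomp_fin (s t : Sinf) : exists n, forall k, (n <= k)%N -> t (s k) = k.
Proof.
have [[n sn] [m tm]] := (sfin s, sfin t); exists (maxn n m) => k.
by rewrite geq_max => /andP[nk mk]; rewrite sn ?tm.
Qed.

Definition sinf1 : Sinf :=
  @MkSinf id id (frefl id) (frefl id) (ex_intro _ 0%N (fun k _ => erefl)).
Definition sinfV (s : Sinf) : Sinf := MkSinf (@sinvK s) (@sfunK s) (sinv_fin s).
Definition sinfM (s t : Sinf) : Sinf :=
  MkSinf (can_comp (@sfunK t) (@sfunK s)) (can_comp (@sinvK s) (@sinvK t))
    (scomp_fin s t).

Fact sinfA : associative sinfM.
Proof. by move=> s t u; apply: sinf_eqP. Qed.
Fact sinf1M : left_id sinf1 sinfM.
Proof. by move=> s; apply: sinf_eqP. Qed.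
Fact sinfM1 : right_id sinf1 sinfM.
Proof. by move=> s; apply: sinf_eqP. Qed.
Fact sinfVM : left_inverse sinf1 sinfV sinfM.
Proof. by move=> s; apply: sinf_eqP => k; apply: sinvK. Qed.
Fact sinfMV : right_inverse sinf1 sinfV sinfM.
Proof. by move=> s; apply: sinf_eqP => k; apply: sfunK. Qed.
HB.instance Definition _ := isGroup.Build Sinf sinfA sinf1M sinfM1 sinfVM sinfMV.

Section Embed.
Variable n : nat.

Definition perm_nat (s : 'S_n) (k : nat) : nat :=
  if insub k is Some i then val (s (i : 'I_n)) else k.

Lemma perm_nat_ord s (i : 'I_n) : perm_nat s i = s i.
Proof. by rewrite /perm_nat valK. Qed.
Lemma perm_nat_out s k : (n <= k)%N -> perm_nat s k = k.
Proof. by move=> nk; rewrite /perm_nat insubF // ltnNge nk. Qed.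
Lemma perm_natM s t k : perm_nat (s * t)%g k = perm_nat t (perm_nat s k).
Proof.
case: (ltnP k n) => [kn|nk]; last by rewrite !perm_nat_out.
by rewrite -[k]/(val (Ordinal kn)) !perm_nat_ord permM.
Qed.
Lemma perm_nat1 k : perm_nat 1%g k = k.
Proof.
case: (ltnP k n) => [kn|nk]; last by rewrite perm_nat_out.
by rewrite -[k]/(val (Ordinal kn)) perm_nat_ord perm1.
Qed.
Lemma perm_natK s : cancel (perm_nat s) (perm_nat s^-1%g).
Proof. by move=> k; rewrite -perm_natM mulgV perm_nat1. Qed.
Lemma perm_natKV s : cancel (perm_nat s^-1%g) (perm_nat s).
Proof. by move=> k; rewrite -perm_natM mulVg perm_nat1. Qed.

Definition embed (s : 'S_n) : Sinf :=
  MkSinf (perm_natK s) (perm_natKV s) (ex_intro _ n (@perm_nat_out s)).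

Lemma embed1 : embed 1%g = 1%g.
Proof. by apply: sinf_eqP => k; apply: perm_nat1. Qed.
Lemma embedM : {morph embed : s t / (s * t)%g}.
Proof. by move=> s t; apply: sinf_eqP => k; apply: perm_natM. Qed.
HB.instance Definition _ := monoid.isMultiplicative.Build 'S_n Sinf embed embedM.
HB.instance Definition _ :=
  Multiplicative_isUMagmaMorphism.Build 'S_n Sinf embed embed1.

Lemma embed_inj : injective embed.
Proof.
move=> s t /(congr1 sfun) st; apply/permP => i; apply: val_inj.
by rewrite /= -!perm_nat_ord; move: (congr1 (@^~ (val i)) st).
Qed.

Lemma embed_surj (g : Sinf) : (forall k, (n <= k)%N -> g k = k) ->
  exists s : 'S_n, embed s = g.
Proof.
move=> gn; have gi (i : 'I_n) : (g i < n)%N.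
  rewrite ltnNge; apply/negP => ni; have /(can_inj (@sfunK g)) e := gn _ ni.
  by move: ni; rewrite e leqNgt ltn_ord.
have h_inj : injective (fun i : 'I_n => Ordinal (gi i)).
  by move=> i j [] /(can_inj (@sfunK g)) /val_inj.
exists (perm h_inj); apply: sinf_eqP => k /=.
case: (ltnP k n) => [kn|nk]; last by rewrite perm_nat_out ?gn.
by rewrite -[k]/(val (Ordinal kn)) perm_nat_ord permE.
Qed.

End Embed.

Lemma embed_lift n (s : 'S_n) : embed (lift_perm ord_max ord_max s) = embed s.
Proof.
apply: sinf_eqP => k /=; case: (ltngtP k n) => [kn|nk|->].
- have -> : k = lift ord_max (Ordinal kn) by rewrite lift_max.
  rewrite perm_nat_ord lift_perm_lift !lift_max.
  by rewrite -[X in perm_nat _ X]/(val (Ordinal kn)) perm_nat_ord.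
- by rewrite !perm_nat_out // ltnW.
- rewrite (perm_nat_out s) // -[n in perm_nat _ n]/(val (@ord_max n)).
  by rewrite perm_nat_ord lift_perm_id.
Qed.

Lemma embed_odd_perm m n (s : 'S_m) (t : 'S_n) :
  embed s = embed t -> odd_perm s = odd_perm t.
Proof.
wlog mn : m n s t / (m <= n)%N.
  move=> IH st; case: (leqP m n) => [mn|/ltnW nm]; first exact: IH.
  exact/esym/IH.
move=> st; rewrite -(subnKC mn) in t st *.
elim: (n - m)%N t st => [|d IH].
  by rewrite addn0 => t /embed_inj ->.
rewrite addnS => t st.
have tfix : t ord_max = ord_max.
  apply: val_inj; rewrite -[LHS]perm_nat_ord.
  by rewrite -[LHS]/(sfun (embed t) _) -st /= perm_nat_out ?leq_addr.
have [u ut] : exists u : 'S_(m + d), embed u = embed t.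
  apply: embed_surj => k; rewrite leq_eqVlt => /predU1P[<-|]; last first.
    exact: perm_nat_out.
  by apply: etrans (perm_nat_ord t ord_max) _; rewrite tfix.
rewrite (IH u) ?ut //; move: ut; rewrite -embed_lift => /embed_inj <-.
by rewrite odd_lift_perm addbb.
Qed.

Definition sinf_odd (g : Sinf) : bool :=
  `[< exists n (s : 'S_n), embed s = g /\ odd_perm s >].

Lemma sinf_odd_embed n (s : 'S_n) : sinf_odd (embed s) = odd_perm s.
Proof.
apply/asboolP/idP => [[m [t [/embed_odd_perm -> //]]]|sodd].
by exists n, s.
Qed.

Lemma embed_pair (g h : Sinf) : exists n (s t : 'S_n), embed s = g /\ embed t = h.
Proof.
have [[n gn] [m hm]] := (sfin g, sfin h).
have [|s sg] := @embed_surj (maxn n m) g.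
  by move=> k; rewrite geq_max => /andP[nk _]; rewrite gn.
have [|t th] := @embed_surj (maxn n m) h.
  by move=> k; rewrite geq_max => /andP[_ mk]; rewrite hm.
by exists (maxn n m), s, t.
Qed.

Lemma sinf_odd1 : sinf_odd 1%g = false.
Proof. by rewrite -(embed1 0) sinf_odd_embed odd_perm1. Qed.
Lemma sinf_oddM g h : sinf_odd (g * h)%g = sinf_odd g (+) sinf_odd h.
Proof.
have [n [s [t [<- <-]]]] := embed_pair g h.
by rewrite -embedM !sinf_odd_embed odd_permM.
Qed.

Section Young.
Variables (i j n : nat) (e : (i + j)%N = n).

Definition young_fun (s : 'S_i) (t : 'S_j) (k : 'I_(i + j)) : 'I_(i + j) :=
  match split k with
  | inl a => lshift j (s a)
  | inr b => rshift i (t b)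
  end.

Lemma young_funK s t : cancel (young_fun s t) (young_fun s^-1%g t^-1%g).
Proof.
move=> k; rewrite /young_fun -[in RHS](splitK k).
case: (split k) => a /=.
  by rewrite -[lshift j _]/(unsplit (inl (s a))) unsplitK permK.
by rewrite -[rshift i _]/(unsplit (inr (t a))) unsplitK permK.
Qed.

Definition young (p : ('S_i * 'S_j)%type) : 'S_n :=
  cast_perm e (perm (can_inj (young_funK p.1 p.2))).

End Young.

Lemma youngM i j n (e : (i + j)%N = n) : {morph young e : p q / (p * q)%g}.
Proof.
case: n / e => p q; rewrite /young !cast_perm_id; apply/permP => k.
rewrite permM !permE /young_fun; case: (split k) => a.
  by rewrite -[lshift j (p.1 a)]/(unsplit (inl (p.1 a))) unsplitK permM.
by rewrite -[rshift i (p.2 a)]/(unsplit (inr (p.2 a))) unsplitK permM.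
Qed.
Lemma young1 i j n (e : (i + j)%N = n) : young e 1%g = 1%g.
Proof. by apply: (mulgI (young e 1%g)); rewrite -youngM !mulg1. Qed.
HB.instance Definition _ i j n (e : (i + j)%N = n) :=
  monoid.isMultiplicative.Build ('S_i * 'S_j)%type 'S_n (young e) (youngM e).
HB.instance Definition _ i j n (e : (i + j)%N = n) :=
  Multiplicative_isUMagmaMorphism.Build ('S_i * 'S_j)%type 'S_n (young e) (young1 e).

Section OneDimensional.
Variables (K : fieldType) (G : groupType) (chi : G -> K).
Hypotheses (chi1 : chi 1%g = 1) (chiM : forall g h, chi (g * h)%g = chi g * chi h).
Definition onedim_act (g : G) (v : K^o) : K^o := chi g *: v.
Lemma onedim_act_linear g : linear (onedim_act g).
Proof. by move=> c u v; rewrite /onedim_act scalerDr !scalerA mulrC. Qed.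
Lemma onedim_act1 v : onedim_act 1%g v = v.
Proof. by rewrite /onedim_act chi1 scale1r. Qed.
Lemma onedim_actM g h v : onedim_act (g * h)%g v = onedim_act g (onedim_act h v).
Proof. by rewrite /onedim_act chiM scalerA. Qed.
Definition onedim : gmodule K G :=
  GModule onedim_act_linear onedim_act1 onedim_actM.
End OneDimensional.

Section Ideals.
Variable K : fieldType.

Definition triv_module : gmodule K Sinf :=
  onedim (chi := fun=> 1) erefl (fun _ _ => esym (mulr1 1)).

Lemma sgn1 : (-1) ^+ sinf_odd 1%g = 1 :> K.
Proof. by rewrite sinf_odd1. Qed.
Lemma sgnM g h :
  (-1) ^+ sinf_odd (g * h)%g = (-1) ^+ sinf_odd g * (-1) ^+ sinf_odd h :> K.
Proof. by rewrite sinf_oddM signr_addb. Qed.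
Definition sgn_module : gmodule K Sinf :=
  onedim (chi := fun g => (-1) ^+ sinf_odd g) sgn1 sgnM.

Definition Jplus : set {malg K[Sinf]} := Ann triv_module.
Definition Jminus : set {malg K[Sinf]} := Ann sgn_module.

(* I intersected with the group algebra of S_n, except that the component of
   index 0 is zero by convention, even for I = setT. *)
Definition component (I : set {malg K[Sinf]}) (n : nat) : set {malg K['S_n]} :=
  if n is 0%N then [set 0] else [set a | I (mpush (@embed n) a)].

Arguments component I n : clear implicits.

Definition dagger_component (I J : set {malg K[Sinf]}) (n : nat) :
    set {malg K['S_n]} :=
  [set a | forall i j (e : (i + j)%N = n),
     Ann (Ind (young e)
            (etens (gquot (component I i : set (regular K 'S_i)))
                   (gquot (component J j : set (regular K 'S_j))))) a].

Arguments dagger_component I J n : clear implicits.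

Definition dagger (I J : set {malg K[Sinf]}) : set {malg K[Sinf]} :=
  \bigcup_(n in [set n | (0 < n)%N]) (mpush (@embed n) @` dagger_component I J n).

Definition dagger_pow (I : set {malg K[Sinf]}) (m : nat) : set {malg K[Sinf]} :=
  iter m (dagger I) setT.

Definition PP (m n : nat) : set {malg K[Sinf]} :=
  dagger (dagger_pow Jplus m) (dagger_pow Jminus n).

Definition lAnn (G H : groupType) (V : gmodule K (G * H)%type) :
  set {malg K[G]} := Ann (res (@linj G H) V).
Definition rAnn (G H : groupType) (V : gmodule K (G * H)%type) :
  set {malg K[H]} := Ann (res (@rinj G H) V).

End Ideals.

Arguments PP K m n : clear implicits.

(* Terms are indexed from 0: alpha i and beta i stand for the (i+1)-st ones. *)
Record Thoma (R : realType) := MkThoma {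
  alpha : nat -> R;
  beta : nat -> R;
  alpha01 : forall i, 0 <= alpha i <= 1;
  beta01 : forall i, 0 <= beta i <= 1;
  alpha_noninc : forall i, alpha i.+1 <= alpha i;
  beta_noninc : forall i, beta i.+1 <= beta i;
  alpha_beta_le1 : (\sum_(i <oo) (alpha i + beta i)%:E <= 1)%E
}.

Definition gamma (R : realType) (w : Thoma R) : \bar R :=
  (\sum_(i <oo) (alpha w i + beta w i)%:E)%E.

Definition power_sum (R : realType) (a : nat -> R) (k : nat) : R :=
  limn (series (fun i => a i ^+ k)).

(* Elements are taken in some S_n; only the non-trivial cycles contribute, so
   that the value does not depend on n. *)
Definition thoma_char (R : realType) (w : Thoma R) n (s : 'S_n) : R :=
  \prod_(c in porbits s | (1 < #|c|)%N)
     (power_sum (alpha w) #|c| + (-1) ^+ #|c|.-1 * power_sum (beta w) #|c|).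

(* The default value 0 is taken exactly on empty and on unbounded sets (and
   is also the maximum of {0}). *)
Definition nat_max (S : set nat) : nat :=
  xget 0%N [set k | S k /\ forall l, S l -> (l <= k)%N].

Definition last_index (R : realType) (a : nat -> R) : nat :=
  nat_max [set i.+1 | i in [set i | a i != 0]].

Section UnitaryRepresentations.
Variable R : realType.
Local Notation C := R[i].

Definition inner (V : lmodType C) := {dot V for @Num.conj C}.

(* Norm convergence: e bounds the square of the norm. *)
Definition norm_cvg (V : lmodType C) (f : inner V) (u : nat -> V) (l : V) :=
  forall e : C, 0 < e -> exists N, forall n, (N <= n)%N -> f (u n - l) (u n - l) < e.

Definition norm_cauchy (V : lmodType C) (f : inner V) (u : nat -> V) :=
  forall e : C, 0 < e -> exists N, forall m n, (N <= m)%N -> (N <= n)%N ->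
    f (u m - u n) (u m - u n) < e.

Record unitary_rep (G : groupType) := UnitaryRep {
  umodule :> gmodule C G;
  uinner : inner umodule;
  ucomplete : forall u, norm_cauchy uinner u -> exists l, norm_cvg uinner u l;
  uisometry : forall g u v, uinner (gact g u) (gact g v) = uinner u v
}.

Definition closed_subspace G (V : unitary_rep G) (S : set V) : Prop :=
  subspace S /\
  forall u l, (forall n, S (u n)) -> norm_cvg (uinner V) u l -> S l.

Definition irreducible_rep G (V : unitary_rep G) : Prop :=
  (exists v : V, v != 0) /\
  forall S : set V, closed_subspace S ->
    (forall g v, S v -> S (gact g v)) -> S = [set 0] \/ S = setT.

Definition spherical_vector (V : unitary_rep (Sinf * Sinf)%type) (v : V) : Prop :=
  v != 0 /\ forall g : Sinf, gact (g, g) v = v.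

(* V is (isomorphic to) the irreducible spherical representation with parameter
   w: the identity chi^w(g) = ((g,e)v,v) is required for g in every S_n, and
   Sinf is the union of the images of the embeddings of the S_n. *)
Definition is_thoma_rep (w : Thoma R) (V : unitary_rep (Sinf * Sinf)%type) :=
  irreducible_rep V /\
  exists v : V, [/\ spherical_vector v, uinner V v v = 1 &
    forall n (s : 'S_n),
      (thoma_char w s)%:C%C = uinner V (gact (embed s, 1%g) v) v].

End UnitaryRepresentations.

(* Main.v *)
Require Import Defs.
From HB Require Import structures.
From mathcomp Require Import all_boot all_order all_algebra all_fingroup.
From mathcomp Require Import finmap monalg complex.
From mathcomp Require Import boolp classical_sets reals ereal.
From mathcomp Require Import topology normedtype sequences.
From mathcomp Require Import zify.
Import Order.TTheory GRing.Theory Num.Theory.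
Import numFieldNormedType.Exports.
Local Open Scope classical_set_scope.
Local Open Scope ring_scope.
Set Implicit Arguments.
Unset Strict Implicit.
Unset Printing Implicit Defensive.

(** The annihilator of T^w is the radical of the positive form attached to the
    character: by irreducibility, a finite combination [b] of group elements acts
    by zero as soon as it kills all translates of the spherical vector [v], and
    since the character is central, each of these translates of [v] is mapped to
    a vector of the same square norm
      sum_(s, t) b_s conj(b_t) chi(t^-1 s)
    (lemma [Ann_thoma_rep]). Both factors give this same form, because
    (g, h) v = (g h^-1, e) v and chi is real.

    To evaluate the form, no classification of the representations of S_n is
    needed; the character is written as a trace instead. Let an alphabet consist
    of even and odd letters with non-negative weights of sum one. On the n-th
    tensor power of the superspace with these letters as basis, the trace of a
    permutation against the product density is the sum over words [x] of the
    weight of [x] times [word_char x], a sign on the stabilizer of [x] and zero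
    elsewhere; it factors along cycles into signed power sums ([word_trace]), as
    the Thoma character does. Each [word_char x] is positive definite, its form
    being an average of squares ([word_form_squares]).

    When the mass of the parameters is one and only [m] of the alphas and [n] of
    the betas are non-zero, these numbers are the weights of an alphabet with [m]
    even and [n] odd letters, and the form vanishes at [b] exactly when the form
    of every word does, that is when [b] annihilates the tensor powers
    ([alphabet_form_eq0]). In the remaining cases the character is a limit of
    traces: the first [M] alphas and betas are taken as letters, and the missing
    mass is spread over M + 1 further even letters, whose power sums of exponent
    at least two tend to zero. Words without repeated letters, whose form is the
    sum of the squared moduli of the coefficients, keep a total weight bounded
    below by a positive constant ([faithful_approx]), so that the limit form is
    positive definite and the annihilator is zero.

    Finally the ideal of elements annihilating the tensor powers of an alphabet
    turns disjoint unions into the operation [dagger] ([dagger_word_ideal]), and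
    a single even or odd letter gives the annihilator of the trivial or of the
    sign representation; hence PP m n is the ideal of the alphabet with [m] even
    and [n] odd letters ([PP_word_ideal]). In one direction, the sign characters
    of words define linear functionals on the induced module. In the other, an
    element of the group algebra of S_n killed by the word characters is shown to
    kill the induced module by writing the unit of the group algebra of each
    factor, modulo the ideal, as a combination of word characters
    ([word_kernel_unit]), which relies on positivity over the complex numbers. *)

Local Notation gact := Defs.gact.

(** * Sign characters of stabilizers of words *)

(** This compares signs of permutations of different sets, and so serves at once
    for conjugation, for fixed points added at the end, and for the two factors
    of a Young subgroup. *)
Lemma odd_perm_extend (T T' : finType) (f : T -> T') (s : {perm T})
    (s' : {perm T'}) : injective f ->
  (forall a, s' (f a) = f (s a)) -> (forall k, k \notin codom f -> s' k = k) ->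
  odd_perm s' = odd_perm s.
Proof.
move=> finj; have [ts -> _] := prod_tpermP s.
elim: ts s' => [|[a b] ts IH] s' s'f s'out.
  rewrite big_nil odd_perm1; suff -> : s' = 1%g by rewrite odd_perm1.
  apply/permP => k; rewrite perm1; have [/codomP[c ->]|/s'out //] := boolP (k \in codom f).
  by rewrite s'f big_nil perm1.
have tf c : tperm (f a) (f b) (f c) = f (tperm a b c).
  have [->|->|/eqP ca /eqP cb] := tpermP a b c; rewrite ?tpermL ?tpermR //.
  by rewrite tpermD // inj_eq // eq_sym.
rewrite big_cons odd_permM odd_tperm /= -(IH (tperm (f a) (f b) * s')%g).
- by rewrite odd_permM odd_tperm (inj_eq finj) addbA addbb.
- by move=> c; rewrite permM tf s'f big_cons permM /= tpermK.
move=> k kf; rewrite permM tpermD ?s'out //.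
  by apply: contraNneq kf => <-; apply: codom_f.
by apply: contraNneq kf => <-; apply: codom_f.
Qed.

Section WordCharacter.
Variables (F : fieldType) (L : eqType) (par : pred L).

Definition word_stab (T : finType) (x : T -> L) (s : {perm T}) : bool :=
  [forall i, x (s i) == x i].

Definition odd_positions (T : finType) (x : T -> L) : {set T} := [set i | par (x i)].

(** With letters as basis vectors of a superspace, even or odd according to
    [par], this is the diagonal matrix coefficient at the word [x] of a
    permutation acting on the tensor power: a sign if it fixes the word. *)
Definition word_char (T : finType) (x : T -> L) (s : {perm T}) : F :=
  if word_stab x s then (-1) ^+ odd_perm (restr_perm (odd_positions x) s) else 0.

Section OneSet.
Variables (T : finType) (x : T -> L).
Implicit Types s t : {perm T}.

Lemma word_stabP s : reflect (forall i, x (s i) = x i) (word_stab x s).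
Proof. by apply: (iffP forallP) => xs i; apply/eqP. Qed.

Lemma word_stab1 : word_stab x 1%g.
Proof. by apply/word_stabP => i; rewrite perm1. Qed.

Lemma word_stabM s t : word_stab x s -> word_stab x (s * t)%g = word_stab x t.
Proof.
move=> /word_stabP xs; apply/word_stabP/word_stabP => xt i; last first.
  by rewrite permM xt xs.
by rewrite -(permKV s i) -permM xt xs.
Qed.

Lemma word_stabV s : word_stab x s^-1 = word_stab x s.
Proof.
by apply/word_stabP/word_stabP => xs i; rewrite -[LHS]xs ?permK ?permKV.
Qed.

Lemma word_stab_astabs s : word_stab x s -> s \in ('N(odd_positions x | 'P))%g.
Proof.
by move=> /word_stabP xs; apply/astabsP => i; rewrite !inE /= apermE xs.
Qed.

Lemma restr_wordE s i : word_stab x s ->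
  restr_perm (odd_positions x) s i = if par (x i) then s i else i.
Proof.
move=> xs; case: ifP => xi.
  by apply: restr_permE; [exact: word_stab_astabs | rewrite inE].
by rewrite (out_perm (restr_perm_on _ _)) // inE xi.
Qed.

Lemma word_char1 : word_char x 1%g = 1.
Proof. by rewrite /word_char word_stab1 morph1 odd_perm1. Qed.

Lemma word_char_neq0 s : (word_char x s != 0) = word_stab x s.
Proof. by rewrite /word_char; case: ifP; rewrite ?eqxx // signr_eq0. Qed.

(** The character is multiplicative as soon as one factor stabilizes the word: both
    sides vanish if the other factor does not. *)
Lemma word_charMl s t : word_char x s != 0 ->
  word_char x (s * t)%g = word_char x s * word_char x t.
Proof.
rewrite word_char_neq0 /word_char => xs; rewrite xs word_stabM //.
case: ifP => xt; last by rewrite mulr0.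
by rewrite morphM ?word_stab_astabs // odd_permM signr_addb.
Qed.

Lemma word_char_real s : word_char x s = 1 \/ word_char x s = -1 \/ word_char x s = 0.
Proof. by rewrite /word_char; case: ifP => _; [case: odd_perm|]; auto. Qed.

Lemma word_char_sqr s : word_char x s * word_char x s = (word_stab x s)%:R.
Proof.
by rewrite /word_char; case: ifP => _; rewrite ?mulr0 // -expr2 sqrr_sign.
Qed.

Lemma word_charV s : word_char x s^-1%g = word_char x s.
Proof.
have [xs|xs] := boolP (word_stab x s); last first.
  by rewrite /word_char word_stabV (negPf xs).
have nz : word_char x s != 0 by rewrite word_char_neq0.
apply: (mulfI nz); rewrite -word_charMl // mulgV word_char1.
by rewrite word_char_sqr xs.
Qed.

End OneSet.

Lemma word_char_extend (T T' : finType) (f : T -> T') (s : {perm T})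
    (s' : {perm T'}) (x : T -> L) (x' : T' -> L) : injective f ->
  (forall a, s' (f a) = f (s a)) -> (forall k, k \notin codom f -> s' k = k) ->
  x' \o f =1 x -> word_char x' s' = word_char x s.
Proof.
move=> finj s'f s'out x'f.
have st : word_stab x' s' = word_stab x s.
  apply/word_stabP/word_stabP => [xs a|xs k].
    by rewrite -!x'f /= -s'f xs.
  have [/codomP[a ->]|/s'out -> //] := boolP (k \in codom f).
  by rewrite s'f; move: (xs a); rewrite -!x'f.
rewrite /word_char st; case: ifP => // xs; congr (_ ^+ nat_of_bool _).
apply: (odd_perm_extend finj) => [a|k kf].
  by rewrite !restr_wordE ?st // s'f -x'f /=; case: ifP.
by rewrite restr_wordE ?st // s'out //; case: ifP.
Qed.

Lemma word_char_conj (T : finType) (x : T -> L) (s g : {perm T}) :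
  word_char (x \o g) s = word_char x (g^-1 * s * g)%g.
Proof.
symmetry; apply: (word_char_extend (f := g)) => //; first exact: perm_inj.
  by move=> a; rewrite !permM permK.
by move=> k; case/negP; rewrite -[k](permKV g) codom_f.
Qed.

(** Conjugation by [g], in the form that moves a translate to the other side. *)
Lemma word_char_shift (T : finType) (x : T -> L) (s g : {perm T}) :
  word_char x (s * g)%g = word_char (x \o g) (g * s)%g.
Proof. by rewrite word_char_conj mulgA mulVg mul1g. Qed.

Lemma eq_word_char (T : finType) (x y : T -> L) : x =1 y -> word_char x =1 word_char y.
Proof. by move=> xy s; apply: (word_char_extend (f := id)) => // k; rewrite codom_f. Qed.

End WordCharacter.

Lemma word_char_map (F : fieldType) (L L' : eqType) (par : pred L) (par' : pred L')
    (f : L -> L') (T : finType) (x : T -> L) (s : {perm T}) :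
  injective f -> par' \o f =1 par ->
  word_char F par' (f \o x) s = word_char F par x s.
Proof.
move=> finj fpar; rewrite /word_char.
have -> : odd_positions par' (f \o x) = odd_positions par x.
  by apply/setP => i; rewrite !inE -fpar.
suff -> : word_stab (f \o x) s = word_stab x s by [].
by apply: eq_forallb => i; rewrite /= inj_eq.
Qed.

(** * Finitely supported combinations *)

Section FiniteBasis.
Variable K : fieldType.

Lemma mlin_fin (X : finType) (V : lmodType K) (f : X -> V) (a : {malg K[X]}) :
  mlin f a = \sum_x a@_x *: f x.
Proof.
rewrite /mlin big_uniq ?finmap.fset_uniq //= big_mkcond; apply: eq_bigr => x _.
by case: ifPn => // /mcoeff_outdom ->; rewrite scale0r.
Qed.

Lemma malg_fin (X : finType) (a : {malg K[X]}) : a = \sum_x a@_x *: << x >>.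
Proof.
rewrite -mlin_fin; apply: (@malg_basisP K X _ idfun (mlin _)) => x /=.
by rewrite mlinU.
Qed.

Lemma mcoeff_fin (X : finType) (c : X -> K) (x : X) :
  (\sum_y c y *: << y >> : {malg K[X]})@_x = c x.
Proof.
rewrite raddf_sum (bigD1 x) //= mcoeffZ mcoeffU eqxx mulr1 big1 ?addr0 // => y yx.
by rewrite mcoeffZ mcoeffU (negPf yx) mulr0.
Qed.

Lemma mlin_mpush (X Y : choiceType) (V : lmodType K) (h : X -> Y) (f : Y -> V)
  (a : {malg K[X]}) : mlin f (mpush h a) = mlin (f \o h) a.
Proof.
apply: (@malg_basisP K X _ (mlin f \o mpush h) (mlin (f \o h))) => x.
by rewrite /= mpushU !mlinU.
Qed.

Lemma mpush_inj (X Y : choiceType) (h : X -> Y) :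
  injective h -> injective (@mpush K X Y h).
Proof.
move=> hinj; apply: raddf_inj => a a0; apply/malgP => x; rewrite mcoeff0.
have : mlin (fun y => (y == h x)%:R : K^o) (mpush h a) = 0 by rewrite a0 linear0.
rewrite mlin_mpush (@mlinEw _ _ _ _ (x |` msupp a)%fset) ?finmap.fsubsetUr //.
rewrite (big_fsetD1 x) ?fset1U1 //= eqxx big1_fset ?addr0 => [|y].
  by rewrite /GRing.scale /= mulr1.
by rewrite !inE => /andP[yx _] _; rewrite (inj_eq hinj) (negPf yx) scaler0.
Qed.

Lemma mcoeff_regular (G : finGroupType) (g s : G) (a : {malg K[G]}) :
  (regular_act g a)@_s = a@_(g^-1 * s)%g.
Proof.
rewrite /regular_act /mpush mlin_fin (reindex_inj (mulgI g^-1%g)) /=.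
rewrite -[RHS](mcoeff_fin (fun t => a@_(g^-1 * t)%g)); congr (_@__).
by apply: eq_bigr => t _; rewrite mulKVg.
Qed.

End FiniteBasis.

Lemma cast_lshiftK i j n (e : (i + j)%N = n) (p : 'S_i * 'S_j) a :
  young e p (cast_ord e (lshift j a)) = cast_ord e (lshift j (p.1 a)).
Proof.
case: n / e; rewrite /young cast_perm_id !cast_ord_id permE /young_fun.
by rewrite -[lshift j a]/(unsplit (inl a)) unsplitK.
Qed.

Lemma cast_rshiftK i j n (e : (i + j)%N = n) (p : 'S_i * 'S_j) b :
  young e p (cast_ord e (rshift i b)) = cast_ord e (rshift i (p.2 b)).
Proof.
case: n / e; rewrite /young cast_perm_id !cast_ord_id permE /young_fun.
by rewrite -[rshift i b]/(unsplit (inr b)) unsplitK.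
Qed.

Lemma cast_splitP i j n (e : (i + j)%N = n) (k : 'I_n) :
  (exists a, k = cast_ord e (lshift j a)) \/ (exists b, k = cast_ord e (rshift i b)).
Proof.
case: n / e k => k; rewrite -[k]splitK; case: (split k) => [a|b].
  by left; exists a; rewrite cast_ord_id.
by right; exists b; rewrite cast_ord_id.
Qed.

Lemma embed_young i j n (e : (i + j)%N = n) (s : 'S_i) :
  embed (young e (s, 1%g)) = embed s.
Proof.
apply: sinf_eqP => k /=; have [kn|nk] := ltnP k n; last first.
  by rewrite !perm_nat_out // (leq_trans _ nk) // -e leq_addr.
rewrite -[k]/(val (Ordinal kn)) perm_nat_ord.
have [[a ->]|[b ->]] := cast_splitP e (Ordinal kn).
  by rewrite cast_lshiftK /= perm_nat_ord.
by rewrite cast_rshiftK perm1 /= perm_nat_out // leq_addr.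
Qed.

(** * The ideal attached to an alphabet of signed letters *)

Section WordIdeal.
Variables (K : fieldType) (L : eqType) (par : pred L).
Local Notation wchar x := (word_char K par x).

(** The annihilator in the group algebra of S_n of the n-th tensor power of the
    superspace with basis [L], which is a sum of modules induced from sign
    characters of stabilizers of words; the equations say that left multiplication
    by [b] kills the signed sum over each of these stabilizers. *)
Definition word_kernel n : set {malg K['S_n]} :=
  [set b | forall (x : 'I_n -> L) u, \sum_s b@_s * wchar x (u * s)%g = 0].

Definition word_ideal : set {malg K[Sinf]} :=
  \bigcup_(n in [set n | (0 < n)%N]) (mpush (@embed n) @` @word_kernel n).

Lemma word_kernel_shift n (b : {malg K['S_n]}) x u v : word_kernel b ->
  \sum_s b@_s * wchar x (u * s * v)%g = 0.
Proof.
move=> /(_ (x \o v) (v * u)%g) b0; rewrite -[RHS]b0; apply: eq_bigr => s _.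
by rewrite word_char_shift mulgA.
Qed.

Lemma word_char_young1 i j n (e : (i + j)%N = n) (z : 'I_n -> L) (s : 'S_i) :
  wchar z (young e (s, 1%g)) = wchar (z \o (fun a => cast_ord e (lshift j a))) s.
Proof.
apply: (word_char_extend _ _ (f := fun a => cast_ord e (lshift j a))) => //.
- by move=> a b /cast_ord_inj /lshift_inj.
- by move=> a; rewrite cast_lshiftK.
move=> k; have [[a ->]|[b ->]] := cast_splitP e k; first by case/negP; apply/codomP; exists a.
by rewrite cast_rshiftK perm1.
Qed.

Lemma word_char_young2 i j n (e : (i + j)%N = n) (z : 'I_n -> L) (t : 'S_j) :
  wchar z (young e (1%g, t)) = wchar (z \o (fun a => cast_ord e (rshift i a))) t.
Proof.
apply: (word_char_extend _ _ (f := fun a => cast_ord e (rshift i a))) => //.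
- by move=> a b /cast_ord_inj /rshift_inj.
- by move=> a; rewrite cast_rshiftK.
move=> k; have [[a ->]|[b ->]] := cast_splitP e k; last by case/negP; apply/codomP; exists b.
by rewrite cast_lshiftK perm1.
Qed.

(** A translate of the stabilizer of [z] meets the image of S_i in a coset of the
    stabilizer of the restricted word, or not at all. *)
Lemma word_char_coset i n (h : 'S_i -> 'S_n) (z : 'I_n -> L) (x : 'S_i -> K)
    (b : {malg K['S_i]}) g : {morph h : s t / (s * t)%g} ->
  (forall s, wchar z (h s) = x s) -> (forall u, \sum_s b@_s * x (u * s)%g = 0) ->
  \sum_s b@_s * wchar z (g * h s)%g = 0.
Proof.
move=> hM hx b0; have [s0 /= nz|gz] := pickP (fun s => wchar z (g * h s)%g != 0).
  transitivity (wchar z (g * h s0)%g * \sum_s b@_s * x (s0^-1 * s)%g).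
    rewrite mulr_sumr; apply: eq_bigr => s _; rewrite mulrCA; congr (_ * _).
    by rewrite -hx -word_charMl // -mulgA -hM mulKVg.
  by rewrite b0 mulr0.
by rewrite big1 // => s _; move/eqP: (gz s) => ->; rewrite mulr0.
Qed.

(** The index of the smaller group is a successor because a word of positive length
    provides a letter with which to extend it. *)
Lemma word_kernel_push i j (b : {malg K['S_i.+1]}) :
  word_kernel (mpush (fun s => young (erefl (i.+1 + j)%N) (s, 1%g)) b) <->
  word_kernel b.
Proof.
set y := fun s => young _ _.
have sumE z u : \sum_s (mpush y b)@_s * wchar z (u * s)%g =
    \sum_s b@_s * wchar z (u * y s)%g.
  transitivity (mlin (fun s => wchar z (u * s)%g : K^o) (mpush y b)).
    by rewrite mlin_fin.
  by rewrite mlin_mpush mlin_fin.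
split=> b0 x u; last first.
  rewrite sumE; apply: word_char_coset => [s t|s|v].
  - by rewrite /y -youngM; congr (young _ _); congr pair; rewrite /= mulg1.
  - exact: word_char_young1.
  exact: b0.
pose z (k : 'I_(i.+1 + j)) := if split k is inl a then x a else x ord0.
rewrite -[RHS](b0 z (y u)) sumE; apply: eq_bigr => s _; congr (_ * _).
rewrite /y -youngM (_ : (_ * _)%g = (u * s, 1)%g :> 'S_i.+1 * 'S_j).
  rewrite word_char_young1; apply: eq_word_char => a /=.
  by rewrite cast_ord_id /z -[lshift j a]/(unsplit (inl a)) unsplitK.
by congr pair; rewrite /= mulg1.
Qed.

(** An element of the ideal may be represented at any level, so this is the
    coherence of the kernels along the inclusions of symmetric groups. At level
    zero the only word is empty and its equation forces the element to vanish, in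
    accordance with the convention for the component of index zero. *)
Lemma component_word_ideal n : @component K word_ideal n = @word_kernel n.
Proof.
rewrite /component; case: n => [|n].
  apply/seteqP; split=> [b /= -> x u|b /= b0].
    by rewrite big1 // => s _; rewrite mcoeff0 mul0r.
  have s1 (s : 'S_0) : s = 1%g by apply/permP => -[].
  have [x _] : exists x : 'I_0 -> L, True.
    by unshelve eexists (fun k => _) => //; case: k.
  apply/malgP => s; rewrite mcoeff0 (s1 s).
  have := b0 x 1%g; rewrite (bigD1 1%g) //= big1 ?addr0 => [|t].
    by rewrite mulg1 word_char1 mulr1.
  by rewrite (s1 t) eqxx.
apply/seteqP; split=> [b [[//|m] /= m0 [a a0 ab]]|b b0]; last first.
  by exists n.+1 => //; exists b.
have push i j (c : {malg K['S_i]}) (c' : {malg K['S_(i + j)]}) :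
    mpush (@embed i) c = mpush (@embed _) c' ->
    c' = mpush (fun s => young (erefl (i + j)%N) (s, 1%g)) c.
  move=> cc; apply: (mpush_inj (@embed_inj _)); rewrite -cc mpush_comp.
  by apply: eq_mpush => s; rewrite -[LHS](embed_young (erefl (i + j)%N)).
have [mn|/ltnW nm] := leqP m.+1 n.+1.
  move: b ab; rewrite -(subnKC mn) => b /push ->.
  by apply/word_kernel_push.
move: a a0 ab; rewrite -(subnKC nm) => a a0 /esym/push aE.
by move: a0; rewrite aE => /word_kernel_push; apply.
Qed.

End WordIdeal.

Arguments word_kernel K [L] par [n] _.
Arguments word_ideal K [L] par _.

Lemma word_ideal_inj (K : fieldType) (L L' : eqType) (par : pred L)
    (par' : pred L') (f : L -> L') : injective f -> par' \o f =1 par ->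
  word_ideal K par' `<=` word_ideal K par.
Proof.
move=> finj fpar a [n n0 [b b0 ba]]; exists n => //; exists b => // x u.
rewrite -[RHS](b0 (f \o x) u); apply: eq_bigr => s _.
by rewrite (word_char_map _ _ _ finj fpar).
Qed.

(** * Splitting off the ideal of an alphabet *)

(** Orthogonal projection of [f] onto the span of the real vectors [M j]: the
    normal equations are solvable because, by positivity, the Gram matrix has the
    same rank as [M]. *)
Lemma least_squares (C : numClosedFieldType) (J S : finType) (M : J -> S -> C)
    (f : S -> C) : (forall j s, (M j s)^* = M j s) ->
  exists c : J -> C, forall j, \sum_s (f s - \sum_k c k * M k s) * M j s = 0.
Proof.
move=> Mreal.
pose A : 'M[C]_(#|J|, #|S|) := \matrix_(i, k) M (enum_val i) (enum_val k).
have ker : (kermx (A *m A^T) <= kermx A)%MS.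
  apply/rV_subP => v /sub_kermxP vAA; apply/sub_kermxP.
  set y := v *m A; suff y0 : \sum_k y ord0 k * (y ord0 k)^* == 0.
    apply/rowP => k; rewrite [RHS]mxE; move: y0.
    rewrite psumr_eq0 => [|i _]; last exact: mul_conjC_ge0.
    by move=> /allP /(_ k (mem_index_enum _)) /=; rewrite mul_conjC_eq0 => /eqP.
  have -> : \sum_k y ord0 k * (y ord0 k)^* = (v *m (A *m A^T) *m (map_mx Num.conj v)^T) ord0 ord0.
    rewrite mulmxA -mulmxA -trmx_mul [in RHS]mxE; apply: eq_bigr => k _.
    congr (_ * _); rewrite /y !mxE rmorph_sum; apply: eq_bigr => i _.
    by rewrite rmorphM !mxE /= Mreal.
  by rewrite vAA mul0mx mxE.
have sub : (A^T <= A *m A^T)%MS.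
  have [le eq] := mxrank_leqif_eq (submxMl A A^T).
  have : (A *m A^T == A^T)%MS.
    rewrite -eq eqn_leq le /= mxrank_tr.
    have := mxrankS ker; rewrite !mxrank_ker => h.
    have [a b] := (rank_leq_row A, rank_leq_row (A *m A^T)).
    by move: h; rewrite leq_subLR addnC -leq_subLR subKn.
  by move=> /andP[].
have [w wE] := submxP (submx_trans (submxMl (\row_k f (enum_val k)) A^T) sub).
exists (fun j => w ord0 (enum_rank j)) => j.
have /rowP/(_ (enum_rank j)) : (\row_k f (enum_val k) - w *m A) *m A^T = 0.
  by rewrite mulmxBl wE mulmxA subrr.
rewrite !mxE => e0; rewrite -[RHS]e0 (reindex _ (onW_bij _ (@enum_val_bij S))) /=.
apply: eq_bigr => k _; rewrite !mxE enum_rankK; congr ((_ - _) * _).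
rewrite (reindex _ (onW_bij _ (@enum_val_bij J))) /=.
by apply: eq_bigr => i _; rewrite mxE enum_valK.
Qed.

Lemma word_char_conjC (C : numClosedFieldType) (L : eqType) (par : pred L)
  (T : finType) (x : T -> L) s : (word_char C par x s)^* = word_char C par x s.
Proof.
by have [->|[->|->]] := word_char_real C par x s; rewrite ?rmorphN ?rmorph1 ?rmorph0.
Qed.

(** The equations of [word_kernel] are orthogonality to the translates of the word
    characters, so the projection of the unit onto the span of these translates
    differs from the unit by an element of the kernel. *)
Lemma word_kernel_unit (C : numClosedFieldType) (L : finType) (par : pred L) n :
  exists (q : {malg C['S_n]}) (c : {ffun 'I_n -> L} * 'S_n -> C),
    word_kernel C par (<< 1%g >> - q) /\
    forall s, q@_s = \sum_p c p * word_char C par p.1 (s * p.2)%g.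
Proof.
have [|c cP] := @least_squares C ({ffun 'I_n -> L} * 'S_n)%type 'S_n
    (fun p s => word_char C par p.1 (s * p.2)%g) (fun s => (1%g == s)%:R).
  by move=> *; apply: word_char_conjC.
pose q : {malg C['S_n]} := \sum_s (\sum_p c p * word_char C par p.1 (s * p.2)%g) *: << s >>.
have qE s : q@_s = \sum_p c p * word_char C par p.1 (s * p.2)%g.
  exact: (mcoeff_fin (fun t => \sum_p c p * word_char C par p.1 (t * p.2)%g)).
exists q, c; split=> // x u.
rewrite -[RHS](cP ([ffun i => (x \o u^-1%g) i], u)); apply: eq_bigr => s _.
rewrite mcoeffB mcoeffU qE; congr (_ * _).
rewrite [RHS]word_char_shift; apply: eq_word_char => i.
by rewrite /= ffunE /= permK.
Qed.

(** * Words in a disjoint union of alphabets *)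

Definition par_sum (X Y : Type) (px : pred X) (py : pred Y) : pred (X + Y) :=
  fun l => match l with inl a => px a | inr b => py b end.

Section Concatenation.
Variables (K : fieldType) (X Y : eqType) (px : pred X) (py : pred Y).
Variables (i j n : nat) (e : (i + j)%N = n).
Local Notation lpos a := (cast_ord e (lshift j a)).
Local Notation rpos b := (cast_ord e (rshift i b)).
Local Notation wsum z := (word_char K (par_sum px py) z).

Definition concat (x : 'I_i -> X) (y : 'I_j -> Y) (k : 'I_n) : X + Y :=
  match split (cast_ord (esym e) k) with
  | inl a => inl (x a)
  | inr b => inr (y b)
  end.

Lemma concat_lpos x y a : concat x y (lpos a) = inl (x a).
Proof. by rewrite /concat cast_ordK -[lshift j a]/(unsplit (inl a)) unsplitK. Qed.

Lemma concat_rpos x y b : concat x y (rpos b) = inr (y b).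
Proof. by rewrite /concat cast_ordK -[rshift i b]/(unsplit (inr b)) unsplitK. Qed.

Variables (x : 'I_i -> X) (y : 'I_j -> Y).

Lemma word_char_concat (p : 'S_i * 'S_j) :
  wsum (concat x y) (young e p) = word_char K px x p.1 * word_char K py y p.2.
Proof.
case: p => s t /=.
have xE : wsum (concat x y) (young e (s, 1%g)) = word_char K px x s.
  rewrite word_char_young1 -(@word_char_map _ _ _ px (par_sum px py) inl) //.
    by apply: eq_word_char => a; rewrite /= concat_lpos.
  by move=> a b [].
have yE : wsum (concat x y) (young e (1%g, t)) = word_char K py y t.
  rewrite word_char_young2 -(@word_char_map _ _ _ py (par_sum px py) inr) //.
    by apply: eq_word_char => a; rewrite /= concat_rpos.
  by move=> a b [].
have [xs0|nz] := eqVneq (word_char K px x s) 0; last first.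
  rewrite -xE -yE -word_charMl ?xE // -youngM.
  by congr (wsum _ (young e _)); congr pair; rewrite /= ?mulg1 ?mul1g.
rewrite xs0 mul0r; apply/eqP; apply: contraTT isT; rewrite word_char_neq0.
move=> /word_stabP st; move/eqP: xs0; rewrite -[_ == 0]negbK word_char_neq0.
case/negP; apply/word_stabP => a.
by have := st (lpos a); rewrite cast_lshiftK !concat_lpos => -[].
Qed.

Lemma young_inj : injective (young e).
Proof.
move=> [s t] [s' t'] /permP eq; congr pair; apply/permP => a.
  by have := eq (lpos a); rewrite !cast_lshiftK => /cast_ord_inj/lshift_inj.
by have := eq (rpos a); rewrite !cast_rshiftK => /cast_ord_inj/rshift_inj.
Qed.

(** The letters at the first [i] positions come from one alphabet and the others
    from the other one, so that a permutation fixing the word respects the two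
    blocks. *)
Lemma stab_concat_young g :
  word_stab (concat x y) g -> exists p, g = young e p.
Proof.
move=> /word_stabP st.
have /choice[s sP] a : exists a', g (lpos a) = lpos a'.
  have [//|[b gb]] := cast_splitP e (g (lpos a)).
  by have := st (lpos a); rewrite gb concat_lpos concat_rpos.
have /choice[t tP] b : exists b', g (rpos b) = rpos b'.
  have [[a ga]|//] := cast_splitP e (g (rpos b)).
  by have := st (rpos b); rewrite ga concat_lpos concat_rpos.
have sinj : injective s.
  move=> a a' ss; have /perm_inj/cast_ord_inj/lshift_inj // : g (lpos a) = g (lpos a').
  by rewrite !sP ss.
have tinj : injective t.
  move=> a a' ss; have /perm_inj/cast_ord_inj/rshift_inj // : g (rpos a) = g (rpos a').
  by rewrite !tP ss.
exists (perm sinj, perm tinj); apply/permP => k.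
have [[a ->]|[b ->]] := cast_splitP e k.
  by rewrite cast_lshiftK sP permE.
by rewrite cast_rshiftK tP permE.
Qed.

Lemma sum_stab_concat (F : 'S_n -> K) r :
  (forall g, ~~ word_stab (concat x y) (g * young e r)%g -> F g = 0) ->
  \sum_p F (young e p) = \sum_g F g.
Proof.
move=> F0; rewrite [RHS](bigID (mem (young e @: setT))) /= [X in _ + X]big1 => [|g gy].
  rewrite addr0 big_imset /=; last by move=> *; apply: young_inj.
  by apply: eq_bigl => p; rewrite in_setT.
apply: F0; apply: contra gy => /stab_concat_young[p gp].
apply/imsetP; exists (p * r^-1)%g; first by rewrite in_setT.
apply: (mulIg (young e r)); rewrite gp -youngM.
by congr (young e _); case: (p) (r) => a b [c d]; congr pair; rewrite /= mulgKV.
Qed.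

End Concatenation.

Lemma concat_sort (X Y : eqType) n (z : 'I_n -> X + Y) :
  exists i j (e : (i + j)%N = n) x y (g : 'S_n), z =1 concat e x y \o g.
Proof.
pose A := [set k | if z k is inl _ then true else false]%SET.
have e : (#|A| + #|~: A|)%N = n by rewrite cardsC card_ord.
have /choice[x xP] (a : 'I_#|A|) : exists l, z (enum_val a) = inl l.
  by have := enum_valP a; rewrite inE; case: (z _) => // l _; exists l.
have /choice[y yP] (b : 'I_#|~: A|) : exists l, z (enum_val b) = inr l.
  by have := enum_valP b; rewrite !inE; case: (z _) => // l _; exists l.
pose h (k : 'I_n) := match split (cast_ord (esym e) k) with
  | inl a => enum_val a | inr b => enum_val b end.
have hl a : h (cast_ord e (lshift _ a)) = enum_val a.
  by rewrite /h cast_ordK -[lshift _ a]/(unsplit (inl a)) unsplitK.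
have hr a : h (cast_ord e (rshift _ a)) = enum_val a.
  by rewrite /h cast_ordK -[rshift _ a]/(unsplit (inr a)) unsplitK.
have hinj : injective h.
  move=> k k'; have [[a ->]|[b ->]] := cast_splitP e k;
    have [[a' ->]|[b' ->]] := cast_splitP e k'; rewrite ?hl ?hr.
  - by move/enum_val_inj ->.
  - move=> eq; have := enum_valP a; rewrite eq.
    by have := enum_valP b'; rewrite finset.inE => /negP.
  - by move=> eq; have := enum_valP b; rewrite eq finset.inE; have := enum_valP a' => ->.
  - by move/enum_val_inj ->.
exists #|A|, #|~: A|, e, x, y, (perm hinj)^-1%g => k /=.
rewrite -[k in z k](permKV (perm hinj)); move: ((perm hinj)^-1%g k) => k'; rewrite permE.
have [[a ->]|[b ->]] := cast_splitP e k'.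
  by rewrite hl xP concat_lpos.
by rewrite hr yP concat_rpos.
Qed.

(** * Annihilators of induced modules *)

Section Factoring.
Variables (K : fieldType) (V W U : lmodType K).

(** The universal property of the quotient: the representatives chosen by [lrepr]
    do not matter for a map that vanishes on [N]. *)
Lemma lquot_factor (N : set V) (f : V -> U) : linear f ->
  (forall v, N v -> f v = 0) -> forall v, f (lrepr (lproj N v)) = f v.
Proof.
move=> fl fN v; apply/eqP; rewrite -subr_eq0 -linear_propB //; apply/eqP.
have : lspan N (lrepr (lproj N v) - v) by apply/lspanP; rewrite -lprojE lreprK.
move=> /(_ [set u | f u = 0]); apply=> [|u Nu]; last exact: fN.
split=> [|c u u' /= u0 u'0]; first exact: linear_prop0.
by rewrite /= fl u0 u'0 scaler0 addr0.
Qed.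

Lemma lquot_factor_linear (N : set V) (f : V -> U) : linear f ->
  (forall v, N v -> f v = 0) -> linear (fun q : lquot N => f (lrepr q)).
Proof.
move=> fl fN c q q'; rewrite -fl -{1}[q]lreprK -{1}[q']lreprK -linearP.
exact: lquot_factor.
Qed.

End Factoring.

Section TensorFactoring.
Variables (K : fieldType) (V W U : lmodType K).

Lemma tens_linearl (w : W) : linear (fun v : V => tens v w).
Proof.
move=> c v v'; apply/eqP; rewrite -subr_eq0 /tens -linearP -linearB lproj_eq0.
apply/lspanP => S _; apply; exists c, v, v', w, w; left.
by rewrite opprD addrA.
Qed.

Lemma tens_linearr (v : V) : linear (fun w : W => tens v w).
Proof.
move=> c w w'; apply/eqP; rewrite -subr_eq0 /tens -linearP -linearB lproj_eq0.
apply/lspanP => S _; apply; exists c, v, v, w, w'; right.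
by rewrite opprD addrA.
Qed.

Variable b : V -> W -> U.
Hypotheses (bl : forall w, linear (b^~ w)) (br : forall v, linear (b v)).

Definition tensor_lift (t : tensor V W) : U := mlin (fun p => b p.1 p.2) (lrepr t).

Let rel0 r : @tensor_rel K V W r -> mlin (fun p => b p.1 p.2) r = 0.
Proof.
move=> [c [v [v' [w [w' rE]]]]].
by case: rE => ->; rewrite !linearB linearZ /= !mlinU /= ?bl ?br addrAC addrK subrr.
Qed.

Lemma tensor_lift_tens v w : tensor_lift (tens v w) = b v w.
Proof.
rewrite /tensor_lift /tens (lquot_factor (f := mlin (fun p => b p.1 p.2))) ?mlinU //.
exact: linearP.
Qed.

Lemma tensor_lift_linear : linear tensor_lift.
Proof.
apply: (lquot_factor_linear (f := mlin (fun p => b p.1 p.2))) => //.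
exact: linearP.
Qed.

End TensorFactoring.

Lemma galg_act_linear (K : fieldType) (G : groupType) (V : gmodule K G)
  (a : {malg K[G]}) : linear (@galg_act K G V a).
Proof.
move=> c u v; rewrite /galg_act /mlin scaler_sumr -big_split /=; apply: eq_bigr => g _.
by rewrite gact_linear scalerDr !scalerA mulrC.
Qed.

Lemma linear_mlin (K : fieldType) (X : choiceType) (V U : lmodType K) (f : V -> U)
  (h : X -> V) (a : {malg K[X]}) : linear f -> f (mlin h a) = mlin (f \o h) a.
Proof.
move=> fl; pose F : {linear _ -> _} := HB.pack f (GRing.isLinear.Build K _ _ _ f fl).
by apply: (@malg_basisP _ _ _ (F \o mlin h) (mlin (f \o h))) => x /=; rewrite !mlinU.
Qed.

Lemma lproj_eq0_factor (K : fieldType) (V U : lmodType K) (N : set V) (f : V -> U) v :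
  linear f -> (forall u, N u -> f u = 0) -> lproj N v = 0 -> f v = 0.
Proof.
move=> fl fN v0; rewrite -(lquot_factor fl fN) v0 -(raddf0 (lproj N)).
by rewrite (lquot_factor fl fN) linear_prop0.
Qed.

Lemma galg_act_quot (K : fieldType) (G : groupType) (V : gmodule K G) (N : set V)
    (a : {malg K[G]}) (v : V) :
  @galg_act K G (gquot N) a (lproj (gsat N) v) = lproj (gsat N) (galg_act a v).
Proof.
rewrite /galg_act (linear_mlin (f := lproj (gsat N))); last exact: linearP.
by apply: eq_bigr => g _ /=; rewrite gquot_actE.
Qed.

(** How linear functionals detect the annihilator of a quotient module. *)
Lemma gsat_factor (K : fieldType) (G : groupType) (V : gmodule K G) (N : set V)
    (U : lmodType K) (f : V -> U) (a : {malg K[G]}) (v : V) : linear f ->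
  (forall u, gsat N u -> f u = 0) -> Ann (gquot N) a ->
  mlin (fun g => f (gact g v)) a = 0.
Proof.
move=> fl fN a0; rewrite -[LHS](linear_mlin (fun g => gact g v) a fl).
by apply: (lproj_eq0_factor fl fN); rewrite -galg_act_quot a0.
Qed.

Lemma lproj_gsat0 (K : fieldType) (G : groupType) (V : gmodule K G) (N : set V) v :
  N v -> lproj (gsat N) v = 0.
Proof.
move=> Nv; apply/eqP; rewrite lproj_eq0; apply/lspanP => S _; apply.
by exists 1%g, v; rewrite Defs.gact1.
Qed.

Lemma linear_malg (K : fieldType) (X : finType) (V : lmodType K)
    (f : {malg K[X]} -> V) (a : {malg K[X]}) : linear f ->
  f a = \sum_x a@_x *: f << x >>.
Proof.
move=> fl; have {1}-> : a = mlin (fun x => << x >>) a by rewrite mlin_fin -malg_fin.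
by rewrite (linear_mlin _ _ fl) mlin_fin.
Qed.

Lemma linear_comb_eq0 (K : fieldType) (I : finType) (V U : lmodType K) (f : V -> U)
  (c : I -> K) (d : I -> V) : linear f -> (forall i, f (d i) = 0) ->
  f (\sum_i c i *: d i) = 0.
Proof.
move=> fl f0; elim/big_rec: _ => [|i v _ v0]; first exact: linear_prop0.
by rewrite fl f0 v0 scaler0 addr0.
Qed.

Lemma bilinear_malg (K : fieldType) (X Y : finType) (V : lmodType K)
    (f : {malg K[X]} -> {malg K[Y]} -> V) a b :
  (forall b, linear (f^~ b)) -> (forall a, linear (f a)) ->
  f a b = \sum_p (a@_p.1 * b@_p.2) *: f << p.1 >> << p.2 >>.
Proof.
move=> fl fr; rewrite -(pair_bigA _ (fun x y => (a@_x * b@_y) *: f << x >> << y >>)) /=.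
rewrite (linear_malg (f := f^~ b) a) //; apply: eq_bigr => x _.
rewrite (linear_malg (f := f << x >>) b) // scaler_sumr.
by apply: eq_bigr => y _; rewrite scalerA.
Qed.

Section InducedClasses.
Variables (K : fieldType) (H G : groupType) (phi : UMagmaMorphism.type H G).
Variable W : gmodule K H.

Definition ind_class (a : {malg K[G]}) (w : W) : Ind phi W :=
  lproj (gsat (ind_rel phi (W := W))) (tens (a : regular K G) w).

Lemma ind_class_linearl w : linear (fun a => ind_class a w).
Proof.
move=> c a a'; apply: etrans (congr1 _ (tens_linearl _ _ _ _)) _.
exact: (linearP (lproj (gsat (ind_rel phi (W := W))))).
Qed.

Lemma ind_class_linearr a : linear (ind_class a).
Proof.
move=> c w w'; apply: etrans (congr1 _ (tens_linearr _ _ _ _)) _.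
exact: (linearP (lproj (gsat (ind_rel phi (W := W))))).
Qed.

Lemma ind_class_move a h w :
  ind_class (mpush (fun g => g * phi h)%g a) w = ind_class a (gact h w).
Proof.
apply/eqP; rewrite -subr_eq0 /ind_class -linearB; apply/eqP/lproj_gsat0.
by exists a, h, w.
Qed.

Lemma ind_class_act g a w :
  gact g (ind_class a w) = ind_class (regular_act g a) w.
Proof.
apply: etrans (@gquot_actE _ _ (ind_pre G W) (ind_rel phi (W := W)) g
  (tens (a : regular K G) w)) _; congr lproj.
apply: etrans (@etens_actE _ _ _ (regular K G) W (linj _ g) a w) _.
by congr tens; apply: Defs.gact1.
Qed.

Lemma ind_class_ext (U : lmodType K) (f : Ind phi W -> U) : linear f ->
  (forall g w, f (ind_class << g >> w) = 0) -> forall v, f v = 0.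
Proof.
move=> fl f0 v; rewrite -[v]lreprK.
apply: (tensor_ext (V := regular K G) (W := W) (g := fun=> 0)
  (f := fun t => f (lproj (gsat (ind_rel phi (W := W))) t))) => [c t t'|c t t'|a w].
- by rewrite -fl; congr f; apply: (linearP (lproj (gsat (ind_rel phi (W := W))))).
- by rewrite scaler0 addr0.
have al : linear (fun a => f (ind_class a w)).
  by move=> c b b'; rewrite ind_class_linearl fl.
pose F : {linear _ -> _} := HB.pack (fun a => f (ind_class a w))
  (GRing.isLinear.Build K _ _ _ (fun a => f (ind_class a w)) al).
by apply: (@malg_basisP _ _ _ F \0) => g; apply: f0.
Qed.

End InducedClasses.

Lemma ind_class_tens_ext (K : fieldType) (H1 H2 G : groupType)
    (phi : UMagmaMorphism.type (H1 * H2)%type G) (V1 : gmodule K H1)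
    (V2 : gmodule K H2) (U : lmodType K) (f : Ind phi (etens V1 V2) -> U) : linear f ->
  (forall g v1 v2, f (@ind_class _ _ _ phi (etens V1 V2) << g >> (tens v1 v2)) = 0) ->
  forall v, f v = 0.
Proof.
move=> fl f0; apply: ind_class_ext => // g.
apply: (tensor_ext (V := V1) (W := V2) (g := fun=> 0)
  (f := fun w => f (@ind_class _ _ _ phi (etens V1 V2) << g >> w))) => [c w1 w2|c w1 w2|v1 v2].
- by rewrite -fl; congr f; apply: (@ind_class_linearr _ _ _ phi (etens V1 V2)).
- by rewrite scaler0 addr0.
exact: f0.
Qed.

Lemma ind_rel_eq0 (K : fieldType) (H G : groupType) (phi : UMagmaMorphism.type H G)
    (W : gmodule K H) (U : lmodType K) (F : tensor (regular K G) W -> U) : linear F ->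
  (forall (a : {malg K[G]}) h w, F (tens (mpush (fun g => g * phi h)%g a : regular K G) w)
    = F (tens (a : regular K G) (gact h w))) ->
  forall r, ind_rel phi r -> F r = 0.
Proof.
move=> Fl Feq _ [a [h [w ->]]]; rewrite (linear_propB Fl).
apply/eqP; rewrite subr_eq0; apply/eqP; exact: Feq.
Qed.

Section Dagger.
Variables (C : numClosedFieldType) (X Y : finType) (px : pred X) (py : pred Y).
Variables (i j n : nat) (e : (i + j)%N = n).

Let V1 : gmodule C 'S_i := gquot (word_kernel C px (n := i) : set (regular C 'S_i)).
Let V2 : gmodule C 'S_j := gquot (word_kernel C py (n := j) : set (regular C 'S_j)).
Let W := etens V1 V2.
Let V := Ind (young e) W.

Let p1 (a : {malg C['S_i]}) : V1 :=
  lproj (gsat (word_kernel C px (n := i) : set (regular C 'S_i))) a.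
Let p2 (b : {malg C['S_j]}) : V2 :=
  lproj (gsat (word_kernel C py (n := j) : set (regular C 'S_j))) b.

Let act1 s a : gact s (p1 a) = p1 (regular_act s a).
Proof. exact: gquot_actE. Qed.
Let act2 t b : gact t (p2 b) = p2 (regular_act t b).
Proof. exact: gquot_actE. Qed.
Let actI k (a : regular C 'S_n) (t : W) :
  gact k (tens a t : ind_pre 'S_n W) = tens (regular_act k a : regular C 'S_n) t.
Proof.
apply: etrans (@etens_actE _ _ _ (regular C 'S_n) W (linj _ k) a t) _.
congr tens; exact: (@Defs.gact1 _ _ W).
Qed.
Let p1_surj v : exists a, v = p1 a.
Proof. by exists (lrepr v); rewrite /p1 lreprK. Qed.
Let p2_surj v : exists b, v = p2 b.
Proof. by exists (lrepr v); rewrite /p2 lreprK. Qed.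

(** The kernels are stable under left translation, hence equal to the submodules
    that they generate. *)
Lemma gsat_word_kernel m (L : finType) (par : pred L) (a : {malg C['S_m]}) :
  gsat (word_kernel C par (n := m) : set (regular C 'S_m)) a -> word_kernel C par a.
Proof.
move=> [g [b [b0 ->]]] x u; rewrite (reindex_inj (mulgI g)) /= -[RHS](b0 x (u * g)%g).
by apply: eq_bigr => s _; rewrite mcoeff_regular mulKg mulgA.
Qed.

Section Functional.
Variables (x : 'I_i -> X) (y : 'I_j -> Y).
Local Notation z := (concat e x y).
Local Notation wz := (word_char C (par_sum px py) z).

(** The value of the translate by [g] of the character of [z], extended linearly, at
    the product of [a] and [b] in the Young subgroup. It vanishes when [a] or [b]
    lies in the kernel of its alphabet, and so carries over, in [pairingW] and
    [pairingI], to the outer tensor product and to the module induced from it. *)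
Definition pairing (g : 'S_n) (a : {malg C['S_i]}) (b : {malg C['S_j]}) : C^o :=
  \sum_p a@_p.1 * b@_p.2 * wz (g * young e p)%g.

Lemma pairing_unit g : pairing g << 1%g >> << 1%g >> = wz g.
Proof.
rewrite /pairing (bigD1 1%g) // big1 => [|[s t]].
  by rewrite /= addr0 !mcoeffU !eqxx !mul1r young1 mulg1.
rewrite -[1%g]/(1%g, 1%g) xpair_eqE negb_and /= => /orP[s1|t1].
  by rewrite mcoeffU eq_sym (negPf s1) !mul0r.
by rewrite [(<< _ >>)@_t]mcoeffU eq_sym (negPf t1) mulr0 mul0r.
Qed.

Lemma pairing_linearl g b : linear (fun a => pairing g a b).
Proof.
move=> c a a'; rewrite /pairing scaler_sumr -big_split; apply: eq_bigr => p _ /=.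
by rewrite mcoeffD mcoeffZ !mulrDl /GRing.scale /= !mulrA.
Qed.

Lemma pairing_linearr g a : linear (pairing g a).
Proof.
move=> c b b'; rewrite /pairing scaler_sumr -big_split; apply: eq_bigr => p _ /=.
rewrite mcoeffD mcoeffZ mulrDr mulrDl; congr (_ + _).
by rewrite /GRing.scale /= !mulrA [a@__ * c]mulrC.
Qed.

Lemma pairing_kernell g a b : word_kernel C px a -> pairing g a b = 0.
Proof.
move=> a0; rewrite /pairing -(pair_bigA _ (fun s t => a@_s * b@_t * wz (g * young e (s, t))%g)).
rewrite exchange_big big1 //= => t _.
transitivity (b@_t * (\sum_s a@_s * wz (g * young e (1%g, t) * young e (s, 1%g))%g)); last first.
  rewrite (word_char_coset (h := fun s => young e (s, 1%g)) (x := word_char C px x)).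
  - by rewrite mulr0.
  - by move=> s s'; rewrite -youngM; congr (young _ _); congr pair; rewrite /= mulg1.
  - by move=> s; rewrite word_char_concat word_char1 mulr1.
  exact: a0.
rewrite mulr_sumr; apply: eq_bigr => s _; rewrite mulrCA mulrA -[in RHS]mulgA -youngM.
by congr (_ * wz (_ * young _ _)%g); congr pair; rewrite /= ?mul1g ?mulg1.
Qed.

Lemma pairing_kernelr g a b : word_kernel C py b -> pairing g a b = 0.
Proof.
move=> b0; rewrite /pairing -(pair_bigA _ (fun s t => a@_s * b@_t * wz (g * young e (s, t))%g)).
rewrite big1 //= => s _.
transitivity (a@_s * (\sum_t b@_t * wz (g * young e (s, 1%g) * young e (1%g, t))%g)); last first.
  rewrite (word_char_coset (h := fun t => young e (1%g, t)) (x := word_char C py y)).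
  - by rewrite mulr0.
  - by move=> t t'; rewrite -youngM; congr (young _ _); congr pair; rewrite /= mulg1.
  - by move=> t; rewrite word_char_concat word_char1 mul1r.
  exact: b0.
rewrite mulr_sumr; apply: eq_bigr => t _; rewrite mulrA -[in RHS]mulgA -youngM.
by congr (_ * wz (_ * young _ _)%g); congr pair; rewrite /= ?mul1g ?mulg1.
Qed.

Definition pairingW (g : 'S_n) : W -> C^o :=
  tensor_lift (fun (v : V1) (v' : V2) => pairing g (lrepr v) (lrepr v')).

Let bl g v' : linear (fun v : V1 => pairing g (lrepr v) v').
Proof.
apply: (lquot_factor_linear (f := fun a => pairing g a v')) => [|a /gsat_word_kernel].
  exact: pairing_linearl.
exact: pairing_kernell.
Qed.

Let br g v : linear (fun v' : V2 => pairing g v (lrepr v')).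
Proof.
apply: (lquot_factor_linear (f := pairing g v)) => [|a /gsat_word_kernel].
  exact: pairing_linearr.
exact: pairing_kernelr.
Qed.

Lemma pairingW_linear g : linear (pairingW g).
Proof. by apply: tensor_lift_linear => v; [exact: bl|exact: br]. Qed.

Lemma pairingW_tens g a b : pairingW g (tens (p1 a) (p2 b)) = pairing g a b.
Proof.
apply: etrans (tensor_lift_tens _ _ _ _) _ => [v|v|]; [exact: bl|exact: br|].
rewrite (lquot_factor (f := fun a => pairing g a _)); first last.
- by move=> c /gsat_word_kernel; exact: pairing_kernell.
- exact: pairing_linearl.
rewrite (lquot_factor (f := pairing g a)) //; first exact: pairing_linearr.
by move=> c /gsat_word_kernel; exact: pairing_kernelr.
Qed.

Lemma pairingW_act g p t : pairingW g (gact p t) = pairingW (g * young e p)%g t.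
Proof.
apply: (tensor_ext (f := pairingW g \o gact p) (g := pairingW (g * young e p)%g)).
- move=> c u v; apply: etrans (congr1 (pairingW g) (@gact_linear _ _ W p c u v)) _.
  exact: pairingW_linear.
- exact: pairingW_linear.
move=> v v'; have [[a ->] [b ->]] := (p1_surj v, p2_surj v').
rewrite /= etens_actE act1 act2 !pairingW_tens /pairing (reindex_inj (mulgI p)) /=.
apply: eq_bigr => q _.
by rewrite !mcoeff_regular !mulKg youngM mulgA.
Qed.

Definition pairingI (g : 'S_n) : tensor (regular C 'S_n) W -> C^o :=
  tensor_lift (fun (a : {malg C['S_n]}) (t : W) => \sum_k a@_k *: pairingW (g * k)%g t).

Let Il g t : linear (fun a : {malg C['S_n]} => \sum_k a@_k *: pairingW (g * k)%g t).
Proof.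
move=> c a a'; rewrite scaler_sumr -big_split; apply: eq_bigr => k _ /=.
by rewrite mcoeffD mcoeffZ scalerDl scalerA.
Qed.

Let Ir g (a : {malg C['S_n]}) : linear (fun t => \sum_k a@_k *: pairingW (g * k)%g t).
Proof.
move=> c t t'; rewrite scaler_sumr -big_split; apply: eq_bigr => k _ /=.
by rewrite pairingW_linear scalerDr !scalerA mulrC.
Qed.

Lemma pairingI_linear g : linear (pairingI g).
Proof. by apply: tensor_lift_linear => v; [exact: Il|exact: Ir]. Qed.

(* [ind_pre] has its own module structure, convertible to that of the tensor
   product. *)
Lemma pairingI_linear_pre g : linear (pairingI g : ind_pre 'S_n W -> C^o).
Proof. exact: pairingI_linear. Qed.

Lemma pairingI_tens g a t : pairingI g (tens a t) = \sum_k a@_k *: pairingW (g * k)%g t.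
Proof. by apply: tensor_lift_tens => v; [exact: Il|exact: Ir]. Qed.

Lemma pairingI_act g k (r : ind_pre 'S_n W) : pairingI g (gact k r) = pairingI (g * k)%g r.
Proof.
apply: (tensor_ext (V := regular C 'S_n) (W := W) (g := pairingI (g * k)%g)
  (f := fun t => pairingI g (@Defs.gact _ _ (ind_pre 'S_n W) k t)) _ _ _ r).
- move=> c u v.
  apply: etrans (congr1 (pairingI g) (@gact_linear _ _ (ind_pre 'S_n W) k c u v)) _.
  exact: pairingI_linear_pre.
- exact: pairingI_linear.
move=> a t; apply: etrans (congr1 (pairingI g) (actI k a t)) _.
rewrite !pairingI_tens (reindex_inj (mulgI k)) /=.
by apply: eq_bigr => h _; rewrite mcoeff_regular mulKg mulgA.
Qed.

Lemma pairingI_rel g r : ind_rel (young e) (W := W) r -> pairingI g r = 0.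
Proof.
apply: ind_rel_eq0 => [|a p t]; first exact: pairingI_linear.
apply: etrans (pairingI_tens g _ t) _.
apply: etrans _ (esym (pairingI_tens g a _)).
rewrite -(mlin_fin (fun k => pairingW (g * k)%g t)) mlin_mpush mlin_fin.
by apply: eq_bigr => k _ /=; rewrite pairingW_act mulgA.
Qed.

(** The generator [v (x) 1 (x) 1] of the induced module is mapped by the functional
    at [u k] to the value of the word character at [u k v]. *)
Lemma Ann_Ind_word_char a : Ann V a -> forall u v, \sum_k a@_k * wz (u * k * v)%g = 0.
Proof.
move=> a0 u v.
have gI g r : gsat (ind_rel (young e) (W := W)) r -> pairingI g r = 0.
  by move=> [k [s [rs ->]]]; rewrite pairingI_act pairingI_rel.
pose t := tens (p1 << 1%g >>) (p2 << 1%g >>) : W.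
pose r : ind_pre 'S_n W := tens (<< v >> : {malg C['S_n]}) t.
apply: etrans _ (gsat_factor (f := pairingI u : ind_pre 'S_n W -> C^o) r
  (@pairingI_linear_pre u) (gI u) a0).
rewrite mlin_fin; apply: eq_bigr => k _; congr (_ * _).
rewrite pairingI_act /r; apply: esym; apply: etrans (pairingI_tens _ _ _) _.
by rewrite -(mlin_fin (fun h => pairingW (u * k * h)%g t)) mlinU pairingW_tens pairing_unit.
Qed.

End Functional.

(** Classes of decomposable tensors; by [cls_move] all are combinations of those
    with units in the last two places. *)
Let cls (a : {malg C['S_n]}) a1 a2 : V :=
  @ind_class _ _ _ (young e) W a (tens (p1 a1) (p2 a2)).

Let cls_linearl a a2 : linear (fun a1 => cls a a1 a2).
Proof.
move=> c b b'; apply: etrans (@ind_class_linearr _ _ _ (young e) W a c _ _).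
congr ind_class; rewrite /p1 linearP; apply: tens_linearl.
Qed.

Let cls_linearr a a1 : linear (fun a2 => cls a a1 a2).
Proof.
move=> c b b'; apply: etrans (@ind_class_linearr _ _ _ (young e) W a c _ _).
congr ind_class; rewrite /p2 linearP; apply: tens_linearr.
Qed.

Let cls_move k s t : cls << k >> << s >> << t >> =
  cls << (k * young e (s, t))%g >> << 1%g >> << 1%g >>.
Proof.
have sE : p1 << s >> = gact s (p1 << 1%g >>) by rewrite act1 /regular_act mpushU mulg1.
have tE : p2 << t >> = gact t (p2 << 1%g >>) by rewrite act2 /regular_act mpushU mulg1.
rewrite -(mpushU C (fun g => g * young e (s, t))%g k) {1}/cls sE tE.
apply: etrans _ (esym (@ind_class_move _ _ _ (young e) W << k >> (s, t) _)).
apply: congr1; exact: esym (@etens_actE _ _ _ V1 V2 (s, t) _ _).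
Qed.

Lemma cls_sum k a1 a2 : cls << k >> a1 a2 =
  \sum_p (a1@_p.1 * a2@_p.2) *: cls << (k * young e p)%g >> << 1%g >> << 1%g >>.
Proof.
apply: etrans (bilinear_malg a1 a2 (cls_linearl << k >>) (cls_linearr << k >>)) _.
by apply: eq_bigr => -[s t] _; rewrite cls_move.
Qed.

(** With the units of the two factors expressed by word characters, the sum over
    the Young subgroup becomes, by [stab_concat_young], a sum over S_n, which is a
    value of the equations satisfied by [a]. *)
Lemma concat_unit_coef (a : {malg C['S_n]}) q1 q2 c1 c2 k h :
  (forall x y u v,
    \sum_g a@_g * word_char C (par_sum px py) (concat e x y) (u * g * v)%g = 0) ->
  (forall s, q1@_s = \sum_(m : {ffun 'I_i -> X} * 'S_i)
    c1 m * word_char C px m.1 (s * m.2)%g) ->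
  (forall t, q2@_t = \sum_(m : {ffun 'I_j -> Y} * 'S_j)
    c2 m * word_char C py m.1 (t * m.2)%g) ->
  \sum_p a@_(k * (young e p)^-1 * h^-1)%g * (q1@_p.1 * q2@_p.2) = 0.
Proof.
move=> a0 q1E q2E.
transitivity (\sum_m \sum_m' (c1 m * c2 m') * \sum_p a@_(k * (young e p)^-1 * h^-1)%g *
    word_char C (par_sum px py) (concat e m.1 m'.1) (young e p * young e (m.2, m'.2))%g).
  under [RHS]eq_bigr do under eq_bigr do rewrite mulr_sumr.
  under [RHS]eq_bigr do rewrite exchange_big.
  rewrite [RHS]exchange_big; apply: eq_bigr => p _ /=.
  rewrite q1E q2E mulr_suml mulr_sumr; apply: eq_bigr => m _.
  rewrite mulr_sumr mulr_sumr; apply: eq_bigr => m' _.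
  by rewrite -youngM word_char_concat /= [X in _ * X = _]mulrACA [LHS]mulrCA.
rewrite big1 // => m _; rewrite big1 // => m' _; set r := (m.2, m'.2).
apply/eqP; rewrite mulf_eq0; apply/orP; right; apply/eqP.
rewrite (sum_stab_concat (x := m.1) (y := m'.1) (r := r)
  (F := fun g => a@_(k * g^-1 * h^-1)%g *
     word_char C (par_sum px py) (concat e m.1 m'.1) (g * young e r)%g)); last first.
  by move=> g; rewrite -(word_char_neq0 C (par_sum px py)) negbK => /eqP ->; rewrite mulr0.
rewrite -[RHS](a0 m.1 m'.1 ((young e r)^-1 * k^-1)%g h).
rewrite (reindex (fun g => h^-1 * g^-1 * k)%g) /=; last first.
  exists (fun g => k * g^-1 * h^-1)%g => g _ /=.
    by rewrite !invMg !invgK !mulgA mulgV mul1g mulgK.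
  by rewrite !invMg !invgK !mulgA mulVg mul1g mulgKV.
apply: eq_bigr => g _; rewrite -[in RHS]word_charV !invMg !invgK !mulgA.
by rewrite mulgV mul1g mulgK.
Qed.

Lemma concat_combination_eq0 (U : lmodType C) (d : 'S_n -> U)
    (a : {malg C['S_n]}) q1 q2 c1 c2 h :
  (forall x y u v,
    \sum_g a@_g * word_char C (par_sum px py) (concat e x y) (u * g * v)%g = 0) ->
  (forall s, q1@_s = \sum_(m : {ffun 'I_i -> X} * 'S_i)
    c1 m * word_char C px m.1 (s * m.2)%g) ->
  (forall t, q2@_t = \sum_(m : {ffun 'I_j -> Y} * 'S_j)
    c2 m * word_char C py m.1 (t * m.2)%g) ->
  (forall k, d k = \sum_p (q1@_p.1 * q2@_p.2) *: d (k * young e p)%g) ->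
  \sum_g a@_g *: d (g * h)%g = 0.
Proof.
move=> a0 q1E q2E dE; under eq_bigr do rewrite dE scaler_sumr.
rewrite exchange_big /=.
transitivity (\sum_p \sum_k
    (a@_(k * (young e p)^-1 * h^-1)%g * (q1@_p.1 * q2@_p.2)) *: d k).
  apply: eq_bigr => p _; rewrite (reindex (fun k => k * (young e p)^-1 * h^-1)%g) /=.
    by apply: eq_bigr => k _; rewrite scalerA !mulgKV.
  by exists (fun k => k * h * young e p)%g => k _; rewrite ?mulgK ?mulgKV.
rewrite exchange_big big1 //= => k _; rewrite -scaler_suml.
by rewrite (concat_unit_coef _ _ a0 q1E q2E) scale0r.
Qed.

(** The function [d] runs over generators of the induced module. Replacing units by
    their expressions modulo the kernels gives the recurrence [dE], along which
    [a] annihilates every [d h]. *)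
Lemma Ann_Ind_of_words (a : {malg C['S_n]}) :
  (forall x y u v,
    \sum_g a@_g * word_char C (par_sum px py) (concat e x y) (u * g * v)%g = 0) ->
  Ann V a.
Proof.
move=> a0.
have [q1 [c1 [k1 q1E]]] := word_kernel_unit C px i.
have [q2 [c2 [k2 q2E]]] := word_kernel_unit C py j.
have p1E : p1 << 1%g >> = p1 q1.
  by apply/eqP; rewrite -subr_eq0 -linearB; apply/eqP/lproj_gsat0.
have p2E : p2 << 1%g >> = p2 q2.
  by apply/eqP; rewrite -subr_eq0 -linearB; apply/eqP/lproj_gsat0.
pose d k := cls << k >> << 1%g >> << 1%g >>.
have dE k : d k = \sum_p (q1@_p.1 * q2@_p.2) *: d (k * young e p)%g.
  by rewrite {1}/d /cls p1E p2E -/(cls _ _ _) cls_sum.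
have actd g h : gact g (d h) = d (g * h)%g.
  apply: etrans (@ind_class_act _ _ _ (young e) W _ _ _) _.
  by rewrite /regular_act mpushU.
have ad h : galg_act a (d h) = 0.
  rewrite -[RHS](concat_combination_eq0 h a0 q1E q2E dE) /galg_act mlin_fin.
  by apply: eq_bigr => g _; rewrite actd.
have al := galg_act_linear (V := V) a.
apply: (ind_class_tens_ext al) => g v1 v2.
have [[a1 ->] [a2 ->]] := (p1_surj v1, p2_surj v2).
apply: etrans (congr1 (galg_act a) (cls_sum g a1 a2)) _.
by apply: (linear_comb_eq0 (d := fun p => d (g * young e p)%g) _ al) => p; apply: ad.
Qed.

End Dagger.

(** The ideal of a disjoint union of alphabets: a word in the union is a
    shuffle of a word in each. *)
Lemma dagger_word_ideal (C : numClosedFieldType) (X Y : finType) (px : pred X)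
    (py : pred Y) :
  dagger (word_ideal C px) (word_ideal C py) = word_ideal C (par_sum px py).
Proof.
apply: eq_bigcupr => n _; congr (_ @` _); apply/seteqP; split=> [a a0 z u|a a0 i j e].
  have [i [j [e [x [y [g zE]]]]]] := concat_sort z.
  have := a0 i j e; rewrite !component_word_ideal => /Ann_Ind_word_char a1.
  rewrite -[RHS](a1 x y (g^-1 * u)%g g); apply: eq_bigr => s _; congr (_ * _).
  rewrite (eq_word_char C _ zE) word_char_conj; congr word_char.
  by rewrite !mulgA.
rewrite !component_word_ideal; apply: Ann_Ind_of_words => x y u v.
exact: word_kernel_shift.
Qed.

Lemma word_ideal_bij (K : fieldType) (L L' : eqType) (par : pred L) (par' : pred L')
    (f : L -> L') (g : L' -> L) : cancel f g -> cancel g f -> par' \o f =1 par ->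
  word_ideal K par' = word_ideal K par.
Proof.
move=> fK gK fpar; apply/seteqP; split.
  by apply: word_ideal_inj fpar; apply: can_inj fK.
apply: (word_ideal_inj (can_inj gK)) => l.
by rewrite /= -fpar /= gK.
Qed.

Lemma malg_embed (K : fieldType) (a : {malg K[Sinf]}) :
  exists n (b : {malg K['S_n]}), (0 < n)%N /\ a = mpush (@embed n) b.
Proof.
have [n n0 nP] : exists2 n, (0 < n)%N & forall g, g \in (msupp a : seq Sinf) ->
    forall k, (n <= k)%N -> g k = k.
  elim: (msupp a : seq Sinf) => [|g s [n n0 nP]]; first by exists 1%N.
  have [m mP] := sfin g; exists (maxn m n) => [|h].
    by rewrite leq_max n0 orbT.
  rewrite inE => /predU1P[->|/nP hP] k; rewrite geq_max => /andP[mk nk].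
    exact: mP.
  exact: hP.
have /choice[h hP] (g : Sinf) : exists s : 'S_n, g \in (msupp a : seq Sinf) -> embed s = g.
  have [gs|gs] := boolP (g \in (msupp a : seq Sinf)); last by exists 1%g.
  by have [s <-] := embed_surj (nP g gs); exists s.
exists n, (\sum_(g <- msupp a) a@_g *: << h g >>); split=> //.
rewrite linear_sum /= {1}(monalgE a) big_seq [RHS]big_seq; apply: eq_bigr => g ga.
rewrite linearZ /= mpushU hP //; apply/malgP => k.
by rewrite mcoeffZ !mcoeffU mulrnAr mulr1.
Qed.

Section SingleLetter.
Variables (C : numClosedFieldType) (b : bool).

Lemma word_char_unit n (x : 'I_n -> unit) s :
  word_char C (fun=> b) x s = (-1) ^+ (b && odd_perm s).
Proof.
have xs : word_stab x s by apply/word_stabP => i; case: (x (s i)) (x i) => -[].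
rewrite /word_char xs; congr (_ ^+ nat_of_bool _).
case: b => /=; last first.
  rewrite (_ : restr_perm _ s = 1%g) ?odd_perm1 //.
  by apply/permP => i; rewrite restr_wordE // perm1.
by congr odd_perm; apply/permP => i; rewrite restr_wordE.
Qed.

Lemma word_ideal_unit (V : gmodule C Sinf) :
  (forall n (s : 'S_n) (v : V), gact (embed s) v = (-1) ^+ (b && odd_perm s) *: v) ->
  (exists v : V, v != 0) -> word_ideal C (fun _ : unit => b) = Ann V.
Proof.
move=> actE [v0 v0n].
pose tot n (a : {malg C['S_n]}) : C := \sum_s a@_s * (-1) ^+ (b && odd_perm s).
have actP n (a : {malg C['S_n]}) (v : V) : galg_act (mpush (@embed n) a) v = tot n a *: v.
  rewrite /tot /galg_act mlin_mpush mlin_fin scaler_suml; apply: eq_bigr => s _.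
  by rewrite /= actE scalerA.
apply/seteqP; split=> [_ [n n0 [a a0 <-]] v|a].
  rewrite actP (_ : tot n a = 0) ?scale0r //.
  rewrite -[RHS](a0 (fun=> tt) 1%g) /tot.
  by apply: eq_bigr => s _; rewrite mul1g word_char_unit.
have [n [c [n0 ->]]] := malg_embed a => /(_ v0) /eqP.
rewrite actP scaler_eq0 (negPf v0n) orbF => /eqP c0; exists n => //; exists c => // x u.
transitivity ((-1) ^+ (b && odd_perm u) * tot n c); last by rewrite c0 mulr0.
rewrite /tot mulr_sumr; apply: eq_bigr => s _.
rewrite mulrCA word_char_unit odd_permM; congr (_ * _).
by case: b; rewrite //= ?signr_addb ?mul1r.
Qed.

(** The empty alphabet has no word of positive length, so its ideal is the whole
    algebra, the identity element of [dagger]. *)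
Lemma dagger_pow_word_ideal m :
  dagger_pow (word_ideal C (fun _ : unit => b)) m = word_ideal C (fun _ : 'I_m => b).
Proof.
elim: m => [|m IH].
  apply/seteqP; split=> // a _; have [n [c [n0 ->]]] := malg_embed a.
  by exists n => //; exists c => //; case: n c n0 => // n c _ x; case: (x ord0).
rewrite /dagger_pow iterS -/(dagger_pow _ m) IH dagger_word_ideal.
pose f (l : 'I_m.+1) : unit + 'I_m := if unlift ord0 l is Some i then inr i else inl tt.
pose g (l : unit + 'I_m) := if l is inr i then lift ord0 i else ord0.
apply: (word_ideal_bij C (f := f) (g := g)).
- by move=> l; rewrite /f; case: unliftP => [i ->|->].
- by move=> [[]|i] /=; rewrite /f ?unlift_none ?liftK.
by move=> l; rewrite /= /f; case: unlift.
Qed.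

End SingleLetter.

Definition letter_par m n : pred ('I_m + 'I_n) := par_sum (fun=> false) (fun=> true).

Lemma PP_word_ideal (C : numClosedFieldType) m n : PP C m n = word_ideal C (@letter_par m n).
Proof.
have one0 : exists v : C^o, v != 0 by exists 1; apply: oner_neq0.
have plus : Jplus (K := C) = word_ideal C (fun _ : unit => false).
  by rewrite (@word_ideal_unit _ _ (triv_module C)).
have minus : Jminus (K := C) = word_ideal C (fun _ : unit => true).
  rewrite (@word_ideal_unit _ _ (sgn_module C)) // => k s v.
  by rewrite /= /onedim_act sinf_odd_embed.
by rewrite /PP plus minus !dagger_pow_word_ideal dagger_word_ideal.
Qed.

(** * Characters of words: traces and positivity *)

Lemma big_porbits (R : Type) (idx : R) (op : Monoid.com_law idx) (T : finType)
    (s : {perm T}) (F : T -> R) :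
  \big[op/idx]_i F i = \big[op/idx]_(c in porbits s) \big[op/idx]_(i in c) F i.
Proof.
rewrite (partition_big (porbit s) (mem (porbits s))) => [|i _]; last exact: imset_f.
apply: eq_bigr => _ /imsetP[j _ ->]; apply: eq_bigl => i /=.
by rewrite eq_porbit_mem.
Qed.

(** A permutation is odd when the numbers of points and of cycles have different
    parities; here the sign is distributed among the cycles. *)
Lemma sign_porbits (F : fieldType) (T : finType) (s : {perm T}) :
  (-1) ^+ odd_perm s = \prod_(c in porbits s) (-1) ^+ (~~ odd #|c|) :> F.
Proof.
transitivity (\prod_(c in porbits s) (-1) ^+ #|c|.+1 : F); last first.
  by apply: eq_bigr => c _; rewrite -signr_odd oddS.
rewrite -expr_sum -[RHS]signr_odd; congr (_ ^+ nat_of_bool _).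
under [in RHS]eq_bigr do rewrite -addn1.
rewrite big_split /= sum1_card oddD /odd_perm; congr (odd _ (+) _).
by rewrite -sum1_card (big_porbits _ s); apply: eq_bigr => c _; rewrite sum1_card.
Qed.

Lemma word_stab_porbit (L : eqType) (T : finType) (x : T -> L) (s : {perm T}) i j :
  word_stab x s -> j \in porbit s i -> x j = x i.
Proof.
move=> /word_stabP xs /porbitP[k ->]; elim: k => [|k IH]; first by rewrite expg0 perm1.
by rewrite expgSr permM xs.
Qed.

Lemma porbit_restr (L : eqType) (par : pred L) (T : finType) (x : T -> L) (s : {perm T}) i :
  word_stab x s -> par (x i) ->
  porbit (restr_perm (odd_positions par x) s) i = porbit s i.
Proof.
move=> xs xi; set t := restr_perm _ s.
suff ts k : (t ^+ k)%g i = (s ^+ k)%g i.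
  by apply/setP => j; apply/porbitP/porbitP => -[k ->]; exists k.
elim: k => [|k IH]; first by rewrite !expg0.
rewrite !expgSr !permM IH /t restr_wordE //.
by rewrite (word_stab_porbit (i := i) xs) ?xi ?mem_porbit.
Qed.

Lemma card_porbit_restr_out (L : eqType) (par : pred L) (T : finType) (x : T -> L)
    (s : {perm T}) i : word_stab x s -> ~~ par (x i) ->
  #|porbit (restr_perm (odd_positions par x) s) i| = 1%N.
Proof.
move=> xs xi; rewrite (_ : porbit _ i = [set i]%SET) ?cards1 //.
apply/setP => j; rewrite finset.in_set1; apply/porbitP/eqP => [[k ->]|->]; last first.
  by exists 0%N; rewrite expg0 perm1.
elim: k => [|k IH]; first by rewrite expg0 perm1.
by rewrite expgSr permM IH restr_wordE // (negPf xi).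
Qed.

(** The cycles of the restriction to odd positions are those of [s] at odd letters,
    and fixed points, which contribute no sign. The function [y] gives the letter
    carried by each cycle. *)
Lemma word_char_porbits (F : fieldType) (L : eqType) (par : pred L) (T : finType)
    (x : T -> L) (s : {perm T}) (y : {set T} -> L) : word_stab x s ->
  (forall i, y (porbit s i) = x i) ->
  word_char F par x s = \prod_(c in porbits s) (-1) ^+ (par (y c) && ~~ odd #|c|).
Proof.
move=> xs yx; rewrite /word_char xs sign_porbits.
set t := restr_perm _ s.
rewrite (bigID (fun c : {set T} => (1 < #|c|)%N)).
rewrite [RHS](bigID (fun c : {set T} => (1 < #|c|)%N && par (y c))) /=.
have small (c : {set T}) u : c \in porbits u -> ~~ (1 < #|c|)%N -> odd #|c|.
  move=> /imsetP[i _ ->]; rewrite -leqNgt; have := card_porbit_neq0 u i.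
  by case: #|_| => // -[].
rewrite [X in _ * X]big1 => [|c /andP[cs c1]]; last by rewrite (small c t).
rewrite [X in _ = _ * X]big1 => [|c /andP[cs]]; last first.
  by case: (par (y c)); rewrite ?andbF // andbT => c1; rewrite (small c s).
rewrite !mulr1; apply: eq_big => [c|c]; last first.
  move=> /andP[/imsetP[i _ ->]]; have [xi|xi] := boolP (par (x i)).
    by rewrite /t porbit_restr // yx xi.
  by rewrite /t card_porbit_restr_out.
apply/andP/and3P => [[/imsetP[i _ ->]]|[/imsetP[i _ ->]]].
  have [xi|xi] := boolP (par (x i)).
    by rewrite /t porbit_restr // yx xi imset_f.
  by rewrite /t card_porbit_restr_out.
by rewrite yx => i1 xi; rewrite i1 -(porbit_restr xs xi) imset_f.
Qed.

(** The trace of a permutation on a tensor power of the superspace, against a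
    product density: a word survives when it is constant on cycles, so that the
    sum over words factors along the cycles. *)
Lemma word_trace (F : fieldType) (L : finType) (par : pred L) (p : L -> F) (l0 : L)
    (T : finType) (s : {perm T}) :
  \sum_(x : {ffun T -> L}) (\prod_i p (x i)) * word_char F par x s =
  \prod_(c in porbits s) \sum_l (-1) ^+ (par l && ~~ odd #|c|) * p l ^+ #|c|.
Proof.
rewrite (big_distr_big l0).
pose h (x : {ffun T -> L}) : {ffun {set T} -> L} :=
  [ffun c => if c \in porbits s then odflt l0 (omap x [pick i in c]) else l0].
pose h' (f : {ffun {set T} -> L}) : {ffun T -> L} := [ffun i => f (porbit s i)].
have hE (x : {ffun T -> L}) i : word_stab x s -> h x (porbit s i) = x i.
  move=> xs; rewrite ffunE imset_f //; case: pickP => [j|/(_ i)]; last by rewrite porbit_id.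
  by apply: word_stab_porbit.
rewrite (reindex_onto h h') => [|f /pffun_onP[/fintype.subsetP supp _]]; last first.
  apply/ffunP => c; rewrite ffunE; case: ifPn => [/imsetP[i _ ->]|cs].
    case: pickP => [j|/(_ i)]; last by rewrite porbit_id.
    by rewrite /= ffunE -eq_porbit_mem => /eqP ->.
  by apply/eqP; rewrite eq_sym; apply: contraNT cs => cs; apply: supp; rewrite inE.
rewrite (bigID (fun x : {ffun T -> L} => word_stab x s)) /= [X in _ + X]big1 ?addr0; last first.
  by move=> x xs; rewrite /word_char (negPf xs) mulr0.
apply: eq_big => [x|x xs].
  apply/idP/andP => [xs|[_ /eqP <-]].
    split; last by apply/eqP/ffunP => i; rewrite ffunE hE.
    apply/pffun_onP; split=> //; apply/fintype.subsetP => c.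
    by rewrite inE ffunE; case: ifP => //; rewrite eqxx.
  apply/word_stabP => i; rewrite [LHS]ffunE [RHS]ffunE; congr (h x _).
  by have := porbit_perm s 1 i; rewrite expg1.
rewrite (word_char_porbits F par xs (y := h x)) => [|i]; last exact: hE.
rewrite (big_porbits _ s) -big_split; apply: eq_bigr => _ /imsetP[i _ ->] /=.
rewrite mulrC; congr (_ * _); rewrite -prodr_const; apply: eq_bigr => j ij.
by rewrite hE // (word_stab_porbit xs ij).
Qed.

(** The square norm of the image under [b] of a vector whose matrix coefficient
    is [phi]. *)
Definition gns_form (C : numClosedFieldType) (G : finGroupType) (phi : G -> C) (b : G -> C) : C :=
  \sum_s \sum_t b s * (b t)^* * phi (t^-1 * s)%g.

Section Positivity.
Variables (C : numClosedFieldType) (L : eqType) (par : pred L) (T : finType).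
Local Notation wchar x := (word_char C par x).

(** A sign character of a subgroup, extended by zero, is positive definite: up to
    the order of the subgroup, its form is a sum of squares over translates. *)
Lemma word_form_squares (x : T -> L) (b : {perm T} -> C) :
  (\sum_u (word_stab x u)%:R) * gns_form (wchar x) b =
  \sum_u (\sum_s b s * wchar x (u * s)%g) * (\sum_s b s * wchar x (u * s)%g)^*.
Proof.
transitivity (\sum_s \sum_t b s * (b t)^* * \sum_u wchar x (u * s)%g * wchar x (u * t)%g).
  rewrite /gns_form mulr_sumr; apply: eq_bigr => s _; rewrite mulr_sumr.
  apply: eq_bigr => t _; rewrite mulrCA; congr (_ * _).
  rewrite [RHS](reindex_inj (mulIg t^-1%g)) mulr_suml; apply: eq_bigr => u _ /=.
  rewrite mulgKV -mulgA; have [xu|xu] := boolP (word_stab x u).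
    by rewrite [wchar x (u * _)%g]word_charMl ?word_char_neq0 // mulrAC word_char_sqr xu.
  by rewrite mul0r [wchar x u]/word_char (negPf xu) mulr0.
rewrite exchange_big /=; under eq_bigr do under eq_bigr do rewrite mulr_sumr.
rewrite exchange_big /=; under eq_bigr do rewrite exchange_big.
rewrite exchange_big /=; apply: eq_bigr => u _.
rewrite mulr_suml; apply: eq_bigr => s _; rewrite rmorph_sum mulr_sumr.
apply: eq_bigr => t _; rewrite rmorphM /= word_char_conjC.
by rewrite mulrACA.
Qed.

Lemma word_stab_card_gt0 (x : T -> L) : 0 < \sum_u (word_stab x u)%:R :> C.
Proof.
rewrite (bigD1 1%g) //= word_stab1 ltr_wpDr ?ltr01 //.
by apply: sumr_ge0 => u _; apply: ler0n.
Qed.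

Lemma word_form_ge0 (x : T -> L) b : 0 <= gns_form (wchar x) b.
Proof.
rewrite -(pmulr_rge0 _ (word_stab_card_gt0 x)) word_form_squares.
by apply: sumr_ge0 => u _; apply: mul_conjC_ge0.
Qed.

Lemma word_form_eq0 (x : T -> L) b :
  gns_form (wchar x) b = 0 <-> forall u, \sum_s b s * wchar x (u * s)%g = 0.
Proof.
split=> [b0 u|b0]; last first.
  apply: (mulfI (lt0r_neq0 (word_stab_card_gt0 x))); rewrite word_form_squares mulr0.
  by rewrite big1 // => u _; rewrite b0 mul0r.
have /eqP := word_form_squares x b; rewrite b0 mulr0 eq_sym.
rewrite psumr_eq0 => [|v _]; last exact: mul_conjC_ge0.
by move=> /allP /(_ u (mem_index_enum _)) /=; rewrite mul_conjC_eq0 => /eqP.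
Qed.

(** A word without repeated letters has trivial stabilizer. *)
Lemma word_form_inj (x : T -> L) b : injective x ->
  gns_form (wchar x) b = \sum_s b s * (b s)^*.
Proof.
move=> xinj; apply: eq_bigr => s _; rewrite (bigD1 s) //= mulVg word_char1 mulr1.
rewrite big1 ?addr0 // => t ts; rewrite /word_char; case: ifP; rewrite ?mulr0 //.
move=> /word_stabP st; case/eqP: ts.
have e : (t^-1 * s)%g = 1%g by apply/permP => i; apply: xinj; rewrite perm1 st.
by rewrite -[RHS](mulKVg t s) e mulg1.
Qed.

End Positivity.

Lemma gns_form_sum (C : numClosedFieldType) (G : finGroupType) (I : finType)
  (c : I -> C) (phi : I -> G -> C) b :
  gns_form (fun g => \sum_i c i * phi i g) b = \sum_i c i * gns_form (phi i) b.
Proof.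
rewrite /gns_form; under [RHS]eq_bigr do rewrite mulr_sumr.
rewrite [RHS]exchange_big; apply: eq_bigr => s _ /=.
under [RHS]eq_bigr do rewrite mulr_sumr.
rewrite [RHS]exchange_big; apply: eq_bigr => t _ /=.
by rewrite mulr_sumr; apply: eq_bigr => i _; rewrite mulrCA.
Qed.

(** * Annihilators of irreducible spherical representations *)

Section Unitary.
Variables (R : realType) (G : groupType) (V : unitary_rep R G).
Local Notation C := R[i].
Local Notation nrm u := (uinner V u u).

Lemma uinner_parallelogram (u v : V) : nrm (u + v) <= 2 * nrm u + 2 * nrm v.
Proof.
have eq : nrm (u + v) + nrm (u - v) = 2 * nrm u + 2 * nrm v.
  rewrite dnormD dnormB addrACA subrr addr0 -!mulrDr.
  by rewrite !mulr_natl !mulr2n.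
by rewrite -eq lerDl dnorm_ge0.
Qed.

Lemma comb_act_linear (I : finType) (b : I -> C) (h : I -> G) :
  linear (fun u : V => \sum_i b i *: gact (h i) u).
Proof.
move=> c u v; rewrite scaler_sumr -big_split; apply: eq_bigr => i _ /=.
by rewrite gact_linear scalerDr !scalerA mulrC.
Qed.

(** This makes the kernel of a combination of group elements closed, for which a
    crude constant is enough. *)
Lemma comb_act_bounded (I : finType) (b : I -> C) (h : I -> G) :
  exists2 K : C, 0 <= K & forall u : V,
    nrm (\sum_i b i *: gact (h i) u) <= K * nrm u.
Proof.
elim: (index_enum I) => [|i s [K K0 KP]].
  by exists 0 => // u; rewrite big_nil mul0r linear0l.
exists (2 * `|b i| ^+ 2 + 2 * K) => [|u].
  by rewrite addr_ge0 // mulr_ge0 // exprn_ge0.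
rewrite big_cons; apply: le_trans (uinner_parallelogram _ _) _.
rewrite [leRHS]mulrDl; apply: lerD; first by rewrite dnormZ uisometry mulrA.
by rewrite -mulrA ler_wpM2l.
Qed.

(** The vectors killed along their whole orbit form a closed invariant subspace. *)
Lemma irreducible_comb_eq0 (I : finType) (b : I -> C) (h : I -> G) (v : V) :
  irreducible_rep V -> v != 0 ->
  (forall p, \sum_i b i *: gact (h i) (gact p v) = 0) ->
  forall u : V, \sum_i b i *: gact (h i) u = 0.
Proof.
move=> [_ irr] v0 bv; pose A u : V := \sum_i b i *: gact (h i) u.
have Al : linear A := @comb_act_linear _ b h.
pose S : set V := [set u | forall p, A (gact p u) = 0].
suff : S = [set 0] \/ S = setT.
  case=> [S0|ST] u; first by have : S v by []; rewrite S0 => /eqP; rewrite (negPf v0).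
  have : S u by rewrite ST.
  by move=> /(_ 1%g); rewrite Defs.gact1.
apply: irr => [|g u uS p]; last by rewrite -Defs.gactM; apply: uS.
split=> [|w l wS wl p].
  split=> [p|c u u' uS u'S p]; first by rewrite (linear_prop0 (gact_linear p)) linear_prop0.
  by rewrite gact_linear Al uS u'S scaler0 addr0.
have [K K0 KP] := comb_act_bounded b h.
apply/eqP; rewrite -(dnorm_eq0 (uinner V)); set N := nrm _.
have N0 : 0 <= N := dnorm_ge0 _ _.
have K1 : 0 < K + 1 by rewrite ltr_wpDl.
move: N0; rewrite le_eqVlt => /predU1P[<- //|N0].
have [|n nP] := wl (N / (K + 1)); first by rewrite divr_gt0.
have := nP n (leqnn n); set d := nrm _ => dN.
have : N <= K * d.
  rewrite /N (_ : A _ = - A (gact p (w n - l))); last first.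
    by rewrite (linear_propB (gact_linear p)) (linear_propB Al) wS sub0r opprK.
  by rewrite hnormN /d -(uisometry p (w n - l)); apply: KP.
move=> Nd; have : N < N; last by rewrite ltxx.
apply: le_lt_trans Nd _; apply: le_lt_trans (_ : K * (N / (K + 1)) < N).
  by rewrite ler_wpM2l // ltW.
by rewrite mulrA ltr_pdivrMr // mulrDr mulr1 mulrC ltrDl.
Qed.

Lemma nrm_comb (I : finType) (b : I -> C) (u : I -> V) :
  nrm (\sum_i b i *: u i) = \sum_i \sum_j b i * (b j)^* * uinner V (u i) (u j).
Proof.
rewrite linear_sumlz; apply: eq_bigr => i _; rewrite linear_sumr; apply: eq_bigr => j _.
by rewrite linearZl_LR linearZr_LR /= mulrA.
Qed.

End Unitary.

Lemma embedV n (s : 'S_n) : embed s^-1 = (embed s)^-1%g :> Sinf.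
Proof. by apply: (mulgI (embed s)); rewrite -embedM mulgV embed1 mulgV. Qed.

Section Spherical.
Variables (R : realType) (w : Thoma R) (T : unitary_rep R (Sinf * Sinf)%type).
Local Notation C := R[i].
Variable v : T.
Hypotheses (v_sph : spherical_vector v)
  (v_char : forall n (s : 'S_n), (thoma_char w s)%:C%C = uinner T (gact (embed s, 1%g) v) v).

Let phi (g : Sinf) : C := uinner T (gact (g, 1%g) v) v.

(** Since [v] is fixed by the diagonal, the right factor acts on it through inverses
    on the left. *)
Lemma sph_inner (x y x' y' : Sinf) :
  uinner T (gact (x, y) v) (gact (x', y') v) = phi (x'^-1 * x * y^-1 * y')%g.
Proof.
have [_ vfix] := v_sph.
have fixr (g h : Sinf) : gact (g, h) v = gact (g * h^-1, 1)%g v :> T.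
  rewrite -{2}(vfix h) -Defs.gactM; congr (gact _ v); congr pair.
    by rewrite /= mulgKV.
  by rewrite /= mul1g.
rewrite -(uisometry (x', y')^-1%g) -!Defs.gactM mulVg Defs.gact1.
rewrite -[((_, _)^-1 * _)%g]/(x'^-1 * x, y'^-1 * y)%g fixr /phi.
by rewrite invMg invgK !mulgA.
Qed.

Lemma phi_trace g h : phi (g * h)%g = phi (h * g)%g.
Proof.
have [_ vfix] := v_sph.
rewrite -[LHS]/(uinner T _ _) -(uisometry (h, h)) -Defs.gactM vfix.
rewrite -[((h, h) * _)%g]/(h * (g * h), h * 1)%g -[X in uinner T _ X]Defs.gact1.
by rewrite sph_inner mulg1 invg1 mul1g mulg1 !mulgA mulgK.
Qed.

Let phi_embed n (s : 'S_n) : phi (embed s) = (thoma_char w s)%:C%C.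
Proof. by rewrite v_char. Qed.

(** The values of the character are real. *)
Lemma phi_embedV n (s : 'S_n) : phi (embed s^-1) = phi (embed s).
Proof.
transitivity ((phi (embed s))^*); last first.
  by rewrite phi_embed; apply/eqP; rewrite eq_complex /= oppr0 !eqxx.
rewrite embedV /phi -[LHS](uisometry (embed s, 1%g)) -Defs.gactM.
rewrite -[((_, _) * _)%g]/(embed s * (embed s)^-1, 1 * 1)%g mulgV mulg1 Defs.gact1.
by rewrite hermC expr0 mul1r.
Qed.

Lemma sph_innerl n (s t : 'S_n) p :
  uinner T (gact (embed s, 1%g) (gact p v)) (gact (embed t, 1%g) (gact p v))
    = (thoma_char w (t^-1 * s)%g)%:C%C.
Proof.
case: p => g k; rewrite -!Defs.gactM.
rewrite -[((embed s, _) * _)%g]/(embed s * g, 1 * k)%g.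
rewrite -[((embed t, _) * _)%g]/(embed t * g, 1 * k)%g.
rewrite sph_inner mul1g invMg !mulgA mulgKV phi_trace !mulgA mulgV mul1g -phi_embed.
by rewrite embedM embedV.
Qed.

Lemma sph_innerr n (s t : 'S_n) p :
  uinner T (gact (1%g, embed s) (gact p v)) (gact (1%g, embed t) (gact p v))
    = (thoma_char w (t^-1 * s)%g)%:C%C.
Proof.
case: p => g k; rewrite -!Defs.gactM.
rewrite -[((_, embed s) * _)%g]/(1 * g, embed s * k)%g.
rewrite -[((_, embed t) * _)%g]/(1 * g, embed t * k)%g.
rewrite sph_inner mul1g mulVg mul1g invMg !mulgA phi_trace !mulgA mulgV mul1g.
by rewrite -phi_embed -phi_embedV invMg invgK embedM embedV.
Qed.

Hypothesis T_irr : irreducible_rep T.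

Lemma Ann_spherical n (a : {malg C['S_n]}) (h : 'S_n -> (Sinf * Sinf)%type) :
  (forall s t p, uinner T (gact (h s) (gact p v)) (gact (h t) (gact p v))
    = (thoma_char w (t^-1 * s)%g)%:C%C) ->
  (forall u : T, \sum_s a@_s *: gact (h s) u = 0) <->
  gns_form (fun s => (thoma_char w s)%:C%C) (fun s => a@_s) = 0.
Proof.
move=> hE.
have nE p : uinner T (\sum_s a@_s *: gact (h s) (gact p v))
    (\sum_s a@_s *: gact (h s) (gact p v)) =
    gns_form (fun s => (thoma_char w s)%:C%C) (fun s => a@_s).
  rewrite nrm_comb; apply: eq_bigr => s _; apply: eq_bigr => t _.
  by rewrite hE.
split=> [a0|a0]; first by rewrite -(nE 1%g) a0 linear0l.
apply: (@irreducible_comb_eq0 _ _ _ _ _ _ v) => // [|p]; first by case: v_sph.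
by apply/eqP; rewrite -(dnorm_eq0 (uinner T)) nE a0.
Qed.

End Spherical.

Lemma Ann_thoma_rep (R : realType) (w : Thoma R) (T : unitary_rep R (Sinf * Sinf)%type)
    n (a : {malg R[i]['S_n]}) : is_thoma_rep w T ->
  let q := gns_form (fun s : 'S_n => (thoma_char w s)%:C%C) (fun s => a@_s) in
  (lAnn T (mpush (@embed n) a) <-> q = 0) /\ (rAnn T (mpush (@embed n) a) <-> q = 0).
Proof.
move=> [irr [v [v_sph _ v_char]]] q; rewrite {}/q; split.
  have [X1 X2] := Ann_spherical v_sph irr a (h := fun s => (embed s, 1%g))
    (fun s t p => sph_innerl v_sph v_char s t p).
  by rewrite /lAnn /Ann /galg_act /=; split=> [a0|a0 u];
    [apply: X1 => u; move: (a0 u)|move: (X2 a0 u)]; rewrite mlin_mpush mlin_fin.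
have [X1 X2] := Ann_spherical v_sph irr a (h := fun s => (1%g, embed s))
  (fun s t p => sph_innerr v_sph v_char s t p).
by rewrite /rAnn /Ann /galg_act /=; split=> [a0|a0 u];
  [apply: X1 => u; move: (a0 u)|move: (X2 a0 u)]; rewrite mlin_mpush mlin_fin.
Qed.

(** * Thoma characters as traces *)

Section AlphabetTrace.
Variables (R : realType) (L : finType) (par : pred L) (p : L -> R).
Local Notation C := R[i].

Lemma word_char_complex (T : finType) (x : T -> L) s :
  (word_char R par x s)%:C%C = word_char C par x s.
Proof. by rewrite /word_char; case: ifP => // _; rewrite (rmorph_sign (real_complex R)). Qed.

Definition alphabet_char n (s : 'S_n) : R :=
  \prod_(c in porbits s | (1 < #|c|)%N)
    \sum_l (-1) ^+ (par l && ~~ odd #|c|) * p l ^+ #|c|.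

(** Fixed points may be left out since the weights have sum one. *)
Lemma alphabet_charE n (s : 'S_n) : \sum_l p l = 1 ->
  alphabet_char s =
  \sum_(x : {ffun 'I_n -> L}) (\prod_i p (x i)) * word_char R par x s.
Proof.
move=> p1; have [l0 _|L0] := pickP (fun _ : L => true); last first.
  by move: p1; rewrite big_pred0 // => /eqP; rewrite eq_sym oner_eq0.
rewrite word_trace // [RHS](bigID (fun c : {set 'I_n} => (1 < #|c|)%N)) /=.
rewrite [X in _ = _ * X]big1 ?mulr1 // => c /andP[/imsetP[i _ ->]].
rewrite -leqNgt => c1; have -> : #|porbit s i| = 1%N.
  by apply/eqP; rewrite eqn_leq c1 lt0n card_porbit_neq0.
by rewrite -p1; apply: eq_bigr => l _; rewrite andbF mul1r expr1.
Qed.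

Hypotheses (p_ge0 : forall l, 0 <= p l) (p1 : \sum_l p l = 1).

Lemma alphabet_formE n (b : 'S_n -> C) :
  gns_form (fun s => (alphabet_char s)%:C%C) b =
  \sum_(x : {ffun 'I_n -> L}) (\prod_i p (x i))%:C%C * gns_form (word_char C par x) b.
Proof.
rewrite -gns_form_sum; apply: eq_bigr => s _; apply: eq_bigr => t _; congr (_ * _).
rewrite alphabet_charE // (rmorph_sum (real_complex R)); apply: eq_bigr => x _.
by rewrite /= rmorphM /= word_char_complex.
Qed.

Lemma word_weight_ge0 n (x : {ffun 'I_n -> L}) : 0 <= (\prod_i p (x i))%:C%C :> C.
Proof. by rewrite ler0c; apply: prodr_ge0. Qed.

Lemma alphabet_form_eq0 n (b : {malg C['S_n]}) : (forall l, 0 < p l) ->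
  gns_form (fun s : 'S_n => (alphabet_char s)%:C%C) (fun s => b@_s) = 0 <->
  word_kernel C par b.
Proof.
move=> p_gt0; rewrite alphabet_formE; split=> [/eqP|b0]; last first.
  rewrite big1 // => x _; apply/eqP; rewrite mulf_eq0; apply/orP; right; apply/eqP.
  by apply/word_form_eq0 => u; apply: b0.
rewrite psumr_eq0 => [/allP b0 x u|x _]; last first.
  by rewrite mulr_ge0 ?word_weight_ge0 ?word_form_ge0.
have := b0 [ffun i => x i] (mem_index_enum _); rewrite mulf_eq0 => /orP[].
  have : 0 < (\prod_i p ([ffun i => x i] i))%:C%C :> C by rewrite (ltcR 0) prodr_gt0.
  by move=> /lt0r_neq0/negPf ->.
move=> /eqP/word_form_eq0/(_ u) e0; rewrite -[RHS]e0; apply: eq_bigr => s _; congr (_ * _).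
by apply: eq_word_char => i; rewrite ffunE.
Qed.

End AlphabetTrace.

Lemma signr_pred (R : pzRingType) k : (0 < k)%N -> (-1) ^+ (~~ odd k) = (-1) ^+ k.-1 :> R.
Proof. by case: k => // k _; rewrite /= negbK signr_odd. Qed.

Section LastIndex.
Variables (R : realType) (a : nat -> R).
Hypotheses (a_ge0 : forall i, 0 <= a i) (a_noninc : forall i, a i.+1 <= a i).

Lemma nonincn i j : (i <= j)%N -> a j <= a i.
Proof. by elim: j => [|j IH]; rewrite leq_eqVlt => /predU1P[<-//|] // /IH; apply: le_trans. Qed.

Lemma last_index_gt0 : (exists i, ~ 0 < a i) -> forall i, (0 < a i) = (i < last_index a)%N.
Proof.
move=> [k0 k0P]; have ex : exists k, a k == 0.
  by exists k0; move/negP: k0P; rewrite lt_neqAle a_ge0 andbT negbK eq_sym.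
case: (ex_minnP ex) => m /eqP am mmin.
have aE i : (0 < a i) = (i < m)%N.
  rewrite lt_neqAle a_ge0 andbT eq_sym; apply/idP/idP => [|im].
    by apply: contraR; rewrite -leqNgt => /nonincn; rewrite am eq_le a_ge0 => ->.
  by apply: contraTN im => /mmin; rewrite -leqNgt.
suff -> : last_index a = m by [].
rewrite /last_index /nat_max; set P := (X in xget _ X).
have aN i : (a i != 0) = (i < m)%N by rewrite -aE lt_neqAle a_ge0 andbT eq_sym.
case: m {am mmin aE} aN => [|m] aN.
  rewrite xgetPN // => k [[i /= ai _] _]; by move: ai; rewrite aN.
have Pm : P m.+1.
  split; first by exists m => //=; rewrite aN.
  by move=> _ [i /= + <-]; rewrite aN.
have [[i /= + eq] max] := xgetPex 0%N (ex_intro P _ Pm); rewrite aN => im.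
apply/eqP; rewrite eqn_leq; apply/andP; split; first by rewrite -eq.
by apply: max; case: Pm.
Qed.

Lemma sum_last_index k M : (exists i, ~ 0 < a i) -> (0 < k)%N -> (last_index a <= M)%N ->
  \sum_(i < M) a i ^+ k = \sum_(i < last_index a) a i ^+ k.
Proof.
move=> a0 k0 mM; rewrite -!(big_mkord xpredT (fun i => a i ^+ k)).
rewrite (big_cat_nat _ mM) //= [X in _ + X]big_nat_cond [X in _ + X]big1 ?addr0 //.
move=> i /andP[/andP[mi _] _]; have : ~~ (0 < a i) by rewrite last_index_gt0 // -leqNgt.
by rewrite lt_neqAle a_ge0 andbT negbK => /eqP <-; rewrite expr0n eqn0Ngt k0.
Qed.

Lemma power_sum_last_index k : (exists i, ~ 0 < a i) -> (0 < k)%N ->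
  power_sum a k = \sum_(i < last_index a) a i ^+ k.
Proof.
move=> a0 k0; apply: lim_near_cst => //; exists (last_index a) => // M /= mM.
by rewrite /series /= big_mkord sum_last_index.
Qed.

End LastIndex.

Section Degenerate.
Variables (R : realType) (w : Thoma R).
Hypotheses (a0 : exists i, ~ 0 < alpha w i) (b0 : exists j, ~ 0 < beta w j).
Hypothesis gamma1 : gamma w = 1%E.
Let m := last_index (alpha w).
Let n := last_index (beta w).

Definition letter_weight (l : 'I_m + 'I_n) : R :=
  match l with inl i => alpha w i | inr j => beta w j end.

Let age0 i : 0 <= alpha w i. Proof. by case/andP: (alpha01 w i). Qed.
Let bge0 i : 0 <= beta w i. Proof. by case/andP: (beta01 w i). Qed.

Lemma letter_weight_gt0 l : 0 < letter_weight l.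
Proof.
case: l => i /=; rewrite last_index_gt0 //; [exact: alpha_noninc|exact: beta_noninc].
Qed.

Lemma big_letters (F : 'I_m + 'I_n -> R) :
  \sum_l F l = \sum_i F (inl i) + \sum_j F (inr j).
Proof. by rewrite big_sumType. Qed.

(** The weights exhaust the mass: this is where the assumption that the parameters
    have mass one enters. *)
Lemma letter_weight_sum : \sum_l letter_weight l = 1.
Proof.
rewrite big_letters /=; apply: EFin_inj; rewrite -[RHS]gamma1; symmetry.
apply: lim_near_cst => //; exists (maxn m n) => // M /=; rewrite geq_max => /andP[mM nM].
rewrite sumEFin big_mkord big_split /=; congr (_ + _)%:E.
  exact: (sum_last_index age0 (alpha_noninc w) a0 (ltn0Sn 0) mM).
exact: (sum_last_index bge0 (beta_noninc w) b0 (ltn0Sn 0) nM).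
Qed.

Lemma thoma_char_letters k (s : 'S_k) :
  thoma_char w s = alphabet_char (@letter_par m n) letter_weight s.
Proof.
apply: eq_bigr => c /andP[_ c1]; have c0 := ltnW c1.
rewrite big_letters /= !power_sum_last_index //; try exact: alpha_noninc; try exact: beta_noninc.
congr (_ + _); first by apply: eq_bigr => i _; rewrite mul1r.
by rewrite mulr_sumr; apply: eq_bigr => j _; rewrite signr_pred.
Qed.

End Degenerate.

(** * Faithful Thoma characters as limits of traces *)

Lemma cvg_bigop_sum (R : realType) (I : Type) (r : seq I) (P : pred I)
    (f : I -> nat -> R) (l : I -> R) : (forall i, P i -> f i @ \oo --> l i) ->
  (fun N => \sum_(i <- r | P i) f i N) @ \oo --> \sum_(i <- r | P i) l i.
Proof.
move=> fl; elim: r => [|i r IH].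
  by under eq_fun do rewrite big_nil; rewrite big_nil; apply: cvg_cst.
under eq_fun do rewrite big_cons; rewrite big_cons.
by case: ifP => // Pi; apply: cvgD IH; apply: fl.
Qed.

Lemma cvg_bigop_prod (R : realType) (I : Type) (r : seq I) (P : pred I)
    (f : I -> nat -> R) (l : I -> R) : (forall i, P i -> f i @ \oo --> l i) ->
  (fun N => \prod_(i <- r | P i) f i N) @ \oo --> \prod_(i <- r | P i) l i.
Proof.
move=> fl; elim: r => [|i r IH].
  by under eq_fun do rewrite big_nil; rewrite big_nil; apply: cvg_cst.
under eq_fun do rewrite big_cons; rewrite big_cons.
by case: ifP => // Pi; apply: cvgM IH; apply: fl.
Qed.

Lemma Re_gns_form (R : realType) (G : finGroupType) (phi : G -> R) (b : G -> R[i]) :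
  complex.Re (gns_form (fun g => (phi g)%:C%C) b) =
  \sum_s \sum_t complex.Re (b s * (b t)^*) * phi (t^-1 * s)%g.
Proof.
have ReD : {morph @complex.Re R : x y / x + y} by move=> [? ?] [? ?].
rewrite (big_morph _ ReD (erefl _)); apply: eq_bigr => s _.
rewrite (big_morph _ ReD (erefl _)); apply: eq_bigr => t _.
by case: (b s * (b t)^*) => x y /=; rewrite mulr0 subr0.
Qed.

Lemma alphabet_form_ge (R : realType) (L : finType) (par : pred L) (p : L -> R) n
    (b : 'S_n -> R[i]) (A : {set {ffun 'I_n -> L}}) (c : R) :
  (forall l, 0 <= p l) -> \sum_l p l = 1 ->
  (forall x : {ffun 'I_n -> L}, x \in A -> injective x) ->
  c <= \sum_(x in A) \prod_i p (x i) ->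
  c%:C%C * (\sum_s b s * (b s)^*) <= gns_form (fun s => (alphabet_char par p s)%:C%C) b.
Proof.
move=> p0 p1 Ainj cA; rewrite alphabet_formE // (bigID (mem A)) /=.
apply: ler_wpDr.
  by apply: sumr_ge0 => x _; rewrite mulr_ge0 ?word_weight_ge0 ?word_form_ge0.
have S0 : 0 <= \sum_s b s * (b s)^* by apply: sumr_ge0 => s _; apply: mul_conjC_ge0.
apply: le_trans (_ : (\sum_(x in A) \prod_i p (x i))%:C%C * (\sum_s b s * (b s)^*) <= _).
  by rewrite ler_wpM2r // lecR.
rewrite (rmorph_sum (real_complex R)) mulr_suml; apply: ler_sum => x xA /=.
by rewrite word_form_inj //; apply: Ainj.
Qed.

Section ThomaLimit.
Variables (R : realType) (w : Thoma R).
Local Notation al := (alpha w).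
Local Notation be := (beta w).

Let al0 i : 0 <= al i. Proof. by case/andP: (alpha01 w i). Qed.
Let be0 i : 0 <= be i. Proof. by case/andP: (beta01 w i). Qed.

Definition defect M : R := 1 - \sum_(i < M) (al i + be i).

Lemma partial_sum_le_gamma M : ((\sum_(i < M) (al i + be i))%:E <= gamma w)%E.
Proof.
rewrite -sumEFin -(big_mkord xpredT (fun i => (al i + be i)%:E)).
by apply: nneseries_lim_ge => i _ _; rewrite lee_fin addr_ge0.
Qed.

Lemma defect_ge0 M : 0 <= defect M.
Proof.
rewrite subr_ge0 -lee_fin; exact: le_trans (partial_sum_le_gamma M) (alpha_beta_le1 w).
Qed.

Lemma defect_le1 M : defect M <= 1.
Proof. by rewrite gerBl; apply: sumr_ge0 => i _; rewrite addr_ge0. Qed.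

(** The letters carrying the first [M] of the alphas and betas, and [M.+1] even
    letters sharing the remaining mass: the power sums of the latter of exponent
    at least two vanish in the limit. *)
Definition approx_letter M := (('I_M + 'I_M) + 'I_M.+1)%type.

Definition approx_par M : pred (approx_letter M) :=
  par_sum (@letter_par M M) (fun=> false).

Definition approx_weight M (l : approx_letter M) : R :=
  match l with
  | inl (inl i) => al i
  | inl (inr j) => be j
  | inr _ => defect M / M.+1%:R
  end.

Lemma approx_weight_ge0 M (l : approx_letter M) : 0 <= approx_weight l.
Proof. by case: l => [[i|j]|k] //=; rewrite divr_ge0 ?defect_ge0. Qed.

Lemma approx_weight_sum M : \sum_(l : approx_letter M) approx_weight l = 1.
Proof.
rewrite !big_sumType /= sumr_const card_ord -big_split /= -[X in _ + X]mulr_natr divfK //.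
by rewrite /defect addrC subrK.
Qed.

Lemma power_sum_cvg (a : nat -> R) k : (forall i, 0 <= a i <= 1) ->
  (forall M, \sum_(i < M) a i <= 1) -> (0 < k)%N ->
  (fun M => \sum_(i < M) a i ^+ k) @ \oo --> power_sum a k.
Proof.
move=> a01 a1 k0.
have a0 i : 0 <= a i ^+ k by rewrite exprn_ge0 //; case/andP: (a01 i).
have -> : (fun M => \sum_(i < M) a i ^+ k) = series (fun i => a i ^+ k).
  by apply/funext => M; rewrite /series /= big_mkord.
apply: nondecreasing_is_cvgn => [i j ij|]; first by apply: nondecreasing_series.
exists 1 => _ [M _ <-]; rewrite /series /= big_mkord; apply: le_trans (a1 M).
apply: ler_sum => i _; rewrite -[leRHS]expr1; have /andP[? ?] := a01 i.
exact: ler_wiXn2l.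
Qed.

Lemma filler_cvg k : (1 < k)%N ->
  (fun M => \sum_(i < M.+1) (defect M / M.+1%:R) ^+ k) @ \oo --> (0 : R).
Proof.
move=> k1; apply: (squeeze_cvgr (f := fun=> 0) (h := harmonic)); last exact: cvg_harmonic.
  apply: nearW => M; have N0 : 0 < M.+1%:R :> R by rewrite ltr0n.
  have y0 : 0 <= defect M / M.+1%:R by rewrite divr_ge0 ?defect_ge0.
  have yN : defect M / M.+1%:R <= M.+1%:R^-1.
    by rewrite ler_pdivrMr // mulVf ?defect_le1 // gt_eqF.
  apply/andP; split; first by apply: sumr_ge0 => i _; apply: exprn_ge0.
  rewrite sumr_const card_ord -[X in X <= _]mulr_natr /=.
  apply: le_trans (_ : (M.+1%:R^-1) ^+ 2 * M.+1%:R <= _); last first.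
    by rewrite expr2 -mulrA mulVf ?mulr1 // gt_eqF.
  rewrite ler_wpM2r ?(ltW N0) //; apply: le_trans (_ : (defect M / M.+1%:R) ^+ 2 <= _).
    by rewrite ler_wiXn2l // (le_trans yN) // invf_le1 // ler1n.
  by rewrite lerXn2r ?nnegrE // invr_ge0 ltW.
exact: cvg_cst.
Qed.

Lemma approx_char_cvg n (s : 'S_n) :
  (fun M => alphabet_char (@approx_par M) (@approx_weight M) s) @ \oo --> thoma_char w s.
Proof.
apply: cvg_bigop_prod => c /andP[_ c1]; have c0 := ltnW c1.
have asum M : \sum_(i < M) (al i + be i) <= 1 by rewrite -subr_ge0; apply: defect_ge0.
rewrite -[X in _ --> X]addr0.
under eq_fun do rewrite !big_sumType /=.
apply: cvgD; last first.
  under eq_fun do under eq_bigr do rewrite mul1r.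
  exact: filler_cvg.
apply: cvgD.
  under eq_fun do under eq_bigr do rewrite mul1r.
  apply: power_sum_cvg => // [|M]; first exact: alpha01.
  by apply: le_trans (asum M); apply: ler_sum => i _; rewrite lerDl.
under eq_fun do rewrite -mulr_sumr signr_pred //.
apply: cvgMr; apply: power_sum_cvg => // [|M]; first exact: beta01.
by apply: le_trans (asum M); apply: ler_sum => i _; rewrite lerDr.
Qed.

(** The real part of the form depends linearly, with real coefficients, on the
    character, so the lower bound passes to the limit. *)
Lemma thoma_form_definite n (c : R) (b : 'S_n -> R[i]) : 0 < c ->
  (\forall M \near \oo, c%:C%C * (\sum_s b s * (b s)^*) <=
     gns_form (fun s => (alphabet_char (@approx_par M) (@approx_weight M) s)%:C%C) b) ->
  gns_form (fun s => (thoma_char w s)%:C%C) b = 0 -> forall s, b s = 0.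
Proof.
move=> c0 low b0; set S := \sum_s _ in low.
have S0 : 0 <= S by apply: sumr_ge0 => s _; apply: mul_conjC_ge0.
have cv : (fun M => complex.Re (gns_form (fun s =>
    (alphabet_char (@approx_par M) (@approx_weight M) s)%:C%C) b)) @ \oo -->
    complex.Re (gns_form (fun s => (thoma_char w s)%:C%C) b).
  rewrite Re_gns_form; under eq_fun do rewrite Re_gns_form.
  apply: cvg_bigop_sum => s _; apply: cvg_bigop_sum => t _.
  by apply: cvgMr; apply: approx_char_cvg.
have : c * complex.Re S <= complex.Re (gns_form (fun s => (thoma_char w s)%:C%C) b).
  apply: cvgr_to_ge cv _; near=> M.
  have : c%:C%C * S <= gns_form (fun s =>
    (alphabet_char (@approx_par M) (@approx_weight M) s)%:C%C) b by near: M.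
  rewrite lecE => /andP[_]; congr (_ <= _).
  by case: (S) => x y /=; rewrite mul0r subr0.
rewrite b0 /= pmulr_rle0 // => Sle.
have SE : S = 0.
  apply/eqP; rewrite eq_le S0 andbT lecE Sle andbT.
  by move: S0; rewrite lecE => /andP[/eqP -> _].
move=> s; move/eqP: SE; rewrite psumr_eq0 => [/allP/(_ s (mem_index_enum _))/=|t _]; last first.
  exact: mul_conjC_ge0.
by rewrite mul_conjC_eq0 => /eqP.
Unshelve. all: by end_near.
Qed.

(** Half of the letters are still available at each of the [n] choices of a letter
    not yet used. *)
Lemma ffact_mass n M (d y : R) : 0 <= d -> (n.*2 <= M.+1)%N -> d / M.+1%:R <= y ->
  (d / 2) ^+ n <= (M.+1 ^_ n)%:R * y ^+ n.
Proof.
move=> d0 nM dy; have y0 : 0 <= y by apply: le_trans dy; rewrite divr_ge0.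
rewrite ffact_prod natr_prod -[n in y ^+ n](card_ord n) -prodr_const -big_split /=.
rewrite -[n in leLHS](card_ord n) -prodr_const; apply: ler_prod => i _.
rewrite divr_ge0 //=; apply: le_trans (_ : (M.+1 - i)%:R * (d / M.+1%:R) <= _); last first.
  by rewrite ler_wpM2l.
rewrite mulrCA ler_wpM2l // ler_pdivlMr ?ltr0n // mulrC ler_pdivrMr //.
rewrite -natrM ler_nat; have := ltn_ord i; lia.
Qed.

(** The words without repeated letters that bound the form from below are those
    written with the filling letters if mass is missing, and otherwise the single
    word listing the first [n] letters of the infinite family. *)
Lemma faithful_approx n (b : 'S_n -> R[i]) :
  (gamma w < 1)%E \/ (forall i, 0 < al i) \/ (forall j, 0 < be j) ->
  exists2 c : R, 0 < c & \forall M \near \oo, c%:C%C * (\sum_s b s * (b s)^*) <=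
     gns_form (fun s => (alphabet_char (@approx_par M) (@approx_weight M) s)%:C%C) b.
Proof.
have big M (c : R) (A : {set {ffun 'I_n -> approx_letter M}}) :
    (forall x : {ffun 'I_n -> approx_letter M}, x \in A -> injective x) ->
    c <= \sum_(x in A) \prod_i approx_weight (x i) ->
    c%:C%C * (\sum_s b s * (b s)^*) <=
    gns_form (fun s => (alphabet_char (@approx_par M) (@approx_weight M) s)%:C%C) b.
  by apply: alphabet_form_ge; [exact: approx_weight_ge0|exact: approx_weight_sum].
have one M (x : {ffun 'I_n -> approx_letter M}) : injective x ->
    (\prod_i approx_weight (x i))%:C%C * (\sum_s b s * (b s)^*) <=
    gns_form (fun s => (alphabet_char (@approx_par M) (@approx_weight M) s)%:C%C) b.
  move=> xinj; apply: (big M _ [set x]%SET) => [y|]; last by rewrite big_set1.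
  by rewrite finset.in_set1 => /eqP ->.
case=> [g1|[a0|b0]].
- have gfin : gamma w \is a fin_num.
    have := partial_sum_le_gamma 0; rewrite big_ord0 => g0.
    by rewrite ge0_fin_numE // (lt_trans g1) // ltry.
  pose d : R := 1 - fine (gamma w).
  have d0 : 0 < d by rewrite subr_gt0 -lte_fin fineK.
  exists ((d / 2) ^+ n); first by rewrite exprn_gt0 // divr_gt0.
  exists n.*2 => // M /= nM.
  pose h (f : {ffun 'I_n -> 'I_M.+1}) : {ffun 'I_n -> approx_letter M} :=
    [ffun i => inr (f i)].
  pose A := [set f : {ffun 'I_n -> 'I_M.+1} | injectiveb f]%SET.
  apply: (big M _ (h @: A)%SET) => [_ /imsetP[f + ->]|].
    by rewrite finset.in_set => /injectiveP finj i j; rewrite !ffunE => -[/finj].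
  rewrite (eq_bigr (fun=> (defect M / M.+1%:R) ^+ n)) => [|_ /imsetP[f _ ->]]; last first.
    rewrite (eq_bigr (fun=> defect M / M.+1%:R)) => [|i _]; last by rewrite ffunE.
    by rewrite prodr_const card_ord.
  rewrite sumr_const card_imset => [|f g /ffunP fg]; last first.
    by apply/ffunP => i; have := fg i; rewrite !ffunE => -[].
  rewrite card_inj_ffuns !card_ord -[leRHS]mulr_natl; apply: ffact_mass; first exact: ltW.
    by rewrite ltnW.
  rewrite ler_wpM2r ?invr_ge0 // lerD2l lerN2 -lee_fin fineK //.
  exact: partial_sum_le_gamma.
- exists (\prod_(i < n) al i); first by rewrite prodr_gt0.
  exists n => // M /= nM.
  pose x : {ffun 'I_n -> approx_letter M} := [ffun i => inl (inl (widen_ord nM i))].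
  have -> : \prod_(i < n) al i = \prod_i approx_weight (x i).
    by apply: eq_bigr => i _; rewrite ffunE.
  by apply: one => i j; rewrite !ffunE => -[] /val_inj.
exists (\prod_(i < n) be i); first by rewrite prodr_gt0.
exists n => // M /= nM.
pose x : {ffun 'I_n -> approx_letter M} := [ffun i => inl (inr (widen_ord nM i))].
have -> : \prod_(i < n) be i = \prod_i approx_weight (x i).
  by apply: eq_bigr => i _; rewrite ffunE.
by apply: one => i j; rewrite !ffunE => -[] /val_inj.
Qed.

End ThomaLimit.

(** * The annihilators *)

Lemma form_ideal_eq (R : realType) (w : Thoma R) (A : set {malg R[i][Sinf]}) :
  (forall n (b : {malg R[i]['S_n]}), A (mpush (@embed n) b) <->
    gns_form (fun s : 'S_n => (thoma_char w s)%:C%C) (fun s => b@_s) = 0) ->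
  let faithful_case :=
    (gamma w < 1)%E \/ (forall i, 0 < alpha w i) \/ (forall j, 0 < beta w j) in
  (faithful_case -> A = [set 0]) /\
  (~ faithful_case -> A = PP R[i] (last_index (alpha w)) (last_index (beta w))).
Proof.
move=> AE; split=> [faithful|nf].
  apply/seteqP; split=> [a|_ ->]; last first.
    rewrite -(raddf0 (mpush (@embed 0))); apply/AE.
    by rewrite /gns_form big1 // => s _; rewrite big1 // => t _; rewrite mcoeff0 !mul0r.
  have [n [b [_ ->]]] := malg_embed a => /AE b0.
  have [c c0 low] := faithful_approx (fun s => b@_s) faithful.
  suff -> : b = 0 by rewrite raddf0.
  by apply/malgP => s; rewrite mcoeff0 (thoma_form_definite c0 low b0).
move/not_orP: nf => [g1 /not_orP[/existsNP a0 /existsNP b0]].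
have gamma1 : gamma w = 1%E.
  by apply/eqP; rewrite eq_le alpha_beta_le1 /= leNgt; apply/negP.
have formE n (b : {malg R[i]['S_n]}) :
    gns_form (fun s : 'S_n => (thoma_char w s)%:C%C) (fun s => b@_s) = 0 <->
    word_kernel R[i] (@letter_par (last_index (alpha w)) (last_index (beta w))) b.
  have -> : (fun s : 'S_n => (thoma_char w s)%:C%C) = (fun s => (alphabet_char
      (@letter_par (last_index (alpha w)) (last_index (beta w)))
      (@letter_weight _ w) s)%:C%C).
    by apply/funext => s; rewrite thoma_char_letters.
  apply: alphabet_form_eq0 => [l||]; last exact: letter_weight_gt0.
    exact/ltW/letter_weight_gt0.
  exact: letter_weight_sum.
rewrite PP_word_ideal; apply/seteqP; split=> [a|_ [n _ [b bk <-]]]; last first.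
  by apply/AE/formE.
have [n [b [n0 ->]]] := malg_embed a => /AE/formE bk.
by exists n => //; exists b.
Qed.

Theorem theorem4p1p1 (R : realType) (w : Thoma R)
    (T : unitary_rep R (Sinf * Sinf)%type) (hT : is_thoma_rep w T) :
  let faithful_case :=
    (gamma w < 1)%E \/ (forall i, 0 < alpha w i) \/ (forall j, 0 < beta w j) in
  (faithful_case -> lAnn T = [set 0] /\ rAnn T = [set 0]) /\
  (~ faithful_case ->
     lAnn T = PP R[i] (last_index (alpha w)) (last_index (beta w)) /\
     rAnn T = PP R[i] (last_index (alpha w)) (last_index (beta w))).
Proof.
have [l1 l2] := form_ideal_eq (fun n b => (Ann_thoma_rep b hT).1).
have [r1 r2] := form_ideal_eq (fun n b => (Ann_thoma_rep b hT).2).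
by split=> h; split; [exact: l1|exact: r1|exact: l2|exact: r2].
Qed.
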